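(* Let $A$ and $B$ be two unbounded normal operators in a Hilbert space such that $B$ is invertible ($A$ is not assumed to be invertible). If $AB=BA$, then $AB$ is normal.
   Context: ''Unbounded operator'' means a linear operator defined on a linear subspace (domain) of a Hilbert space $H$, not necessarily bounded. A densely defined operator $T$ is normal if it is closed and $TT^*=T^*T$ (including equality of domains). $B$ is invertible if it has an everywhere defined bounded inverse $B^{-1}\in B(H)$. Products carry their natural domains, e.g. $D(AB)=\{x\in D(B): Bx\in D(A)\}$, and $AB=BA$ includes equality of domains. *)

(* Defs.v *)
From HB Require Import structures.
From mathcomp Require Import all_boot all_order all_algebra sesquilinear.
From mathcomp Require Import complex.
From mathcomp Require Import all_classical all_reals all_analysis.

Set Implicit Arguments.
Unset Strict Implicit.
Unset Printing Implicit Defensive.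

Import Order.TTheory GRing.Theory Num.Theory.
Import numFieldNormedType.Exports.

Local Open Scope classical_set_scope.
Local Open Scope ring_scope.

(* The norm of a normedModType over R[i] takes its values in R[i] (it is a
   nonnegative real there), hence [innerE] is an equation in R[i].
   [inner] is linear in its first argument and conjugate-linear in the second. *)
HB.mixin Record CompleteNormedModule_isHilbert (R : realType) H
    & CompleteNormedModule R[i] H := {
  inner : {dot H for (@Num.conj R[i])} ;
  innerE : forall x : H, `|x| ^+ 2 = inner x x
}.

#[short(type="hilbertType")]
HB.structure Definition Hilbert (R : realType) :=
  {H of CompleteNormedModule R[i] H & CompleteNormedModule_isHilbert R H}.

Section Operators.
Context {R : realType} {H : hilbertType R}.
Implicit Types x y z : H.

(* The values of [app] outside [dom] are irrelevant; in particular equality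
   of operators is [op_eq] below, not Leibniz equality. *)
Record operator := Operator {
  dom : set H ;
  app :> H -> H ;
  dom0 : dom 0 ;
  domP : forall a x y, dom x -> dom y -> dom (a *: x + y) ;
  appP : forall a x y, dom x -> dom y -> app (a *: x + y) = a *: app x + app y
}.
Implicit Types S T : operator.

Definition op_eq S T := dom S = dom T /\ forall x, dom S x -> S x = T x.

Lemma app0 T : T 0 = 0.
Proof.
have := appP (-1) (dom0 T) (dom0 T).
by rewrite scaler0 addr0 scaleN1r addNr.
Qed.

Definition comp_dom S T := [set x | dom T x /\ dom S (T x)].

Fact comp_dom0 S T : comp_dom S T 0.
Proof. by split; rewrite ?app0; exact: dom0. Qed.

Fact comp_domP S T a x y :
  comp_dom S T x -> comp_dom S T y -> comp_dom S T (a *: x + y).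
Proof.
by move=> [xT xS] [yT yS]; split; rewrite ?appP//; exact: domP.
Qed.

Fact comp_appP S T a x y : comp_dom S T x -> comp_dom S T y ->
  S (T (a *: x + y)) = a *: S (T x) + S (T y).
Proof. by move=> [xT xS] [yT yS]; rewrite !appP. Qed.

Definition op_comp S T : operator :=
  Operator (@comp_dom0 S T) (@comp_domP S T) (@comp_appP S T).

Definition densely_defined T := dense (dom T).

Definition closed_op T := closed [set p : H * H | dom T p.1 /\ p.2 = T p.1].

Definition adjoint_at T y z := forall x, dom T x -> inner (T x) y = inner x z.

Lemma dense_inner_eq0 (D : set H) z :
  dense D -> (forall x, D x -> inner x z = 0) -> z = 0.
Proof.
move=> dD Dz; apply/eqP/negP => /negP z0.
have [x [zx Dx]] : ball z `|z| `&` D !=set0.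
  apply: dD; last exact: ball_open.
  by exists z; apply: ballxx; rewrite normr_gt0.
have := Dz _ Dx => xz.
have zx0 : inner z x = 0.
  by rewrite (hermitian_subproof _ x)/= xz rmorph0 mulr0.
move: zx; rewrite -ball_normE /ball_/=.
rewrite -(@ltr_pXn2r _ 2) ?nnegrE ?normr_ge0 ?innerE ?normr_id //.
rewrite linearBl !linearBr/= xz zx0 subr0 sub0r opprK => /lt_geF.
by rewrite lerDl -innerE exprn_ge0.
Qed.

Lemma adjoint_at_unique T y z z' : densely_defined T ->
  adjoint_at T y z -> adjoint_at T y z' -> z = z'.
Proof.
move=> dT yz yz'; apply/eqP; rewrite -subr_eq0; apply/eqP.
apply: (dense_inner_eq0 dT) => x Tx.
by rewrite linearBr/= -yz// -yz'// subrr.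
Qed.

Lemma adjoint_atP T a y y' z z' : adjoint_at T y z -> adjoint_at T y' z' ->
  adjoint_at T (a *: y + y') (a *: z + z').
Proof. by move=> yz yz' x Tx; rewrite !linearPr/= yz// yz'. Qed.

Section Adjoint.
Variables (T : operator) (dT : densely_defined T).

Definition adjoint_dom := [set y | exists z, adjoint_at T y z].
Definition adjoint_app y := xget 0 (adjoint_at T y).

Lemma adjoint_appE y z : adjoint_at T y z -> adjoint_app y = z.
Proof.
move=> yz; apply: (adjoint_at_unique dT _ yz).
by rewrite /adjoint_app; apply: (@xgetPex _ 0 (adjoint_at T y)); exists z.
Qed.

Fact adjoint_dom0 : adjoint_dom 0.
Proof. by exists 0 => x _; rewrite !linear0r. Qed.

Fact adjoint_domP a y y' :
  adjoint_dom y -> adjoint_dom y' -> adjoint_dom (a *: y + y').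
Proof.
by move=> [z yz] [z' yz']; exists (a *: z + z'); exact: adjoint_atP.
Qed.

Fact adjoint_appP a y y' : adjoint_dom y -> adjoint_dom y' ->
  adjoint_app (a *: y + y') = a *: adjoint_app y + adjoint_app y'.
Proof.
move=> [z yz] [z' yz']; rewrite (adjoint_appE yz) (adjoint_appE yz').
by apply: adjoint_appE; exact: adjoint_atP.
Qed.

Definition op_adjoint : operator :=
  Operator adjoint_dom0 adjoint_domP adjoint_appP.

End Adjoint.

Definition normal_op T := exists dT : densely_defined T,
  closed_op T /\ op_eq (op_comp T (op_adjoint dT)) (op_comp (op_adjoint dT) T).

Definition invertible_op T := exists S : {linear H -> H},
  [/\ exists M : R[i], forall x, `|S x| <= M * `|x|,
      forall x, dom T (S x) /\ T (S x) = x
    & forall x, dom T x -> S (T x) = x].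

End Operators.

Arguments operator {R} H.

(* Main.v *)
Require Import Defs.
From mathcomp Require Import all_boot all_order all_algebra sesquilinear.
From mathcomp Require Import complex ring lra.
From mathcomp Require Import all_classical all_reals all_analysis.

(** The proof is elementary: it uses neither a spectral theorem nor complex
    function theory. Write S = B^-1, a bounded operator. From AB = BA one gets
    SA ⊂ AS. The core is Fuglede's theorem ([fuglede]): then also SA* ⊂ A*S;
    taking adjoints, S* commutes with A and A* as well.

    Fuglede's theorem for an unbounded normal A. For r >= 0, let [band A r] be
    the set of the vectors x with |A^k x| = O(r^k). It is the spectral subspace
    of the disc of radius r, but its definition makes it visibly invariant
    under S. Normality gives |A^k x| = |A*^k x|, so the bands of A and A*
    coincide; as S* commutes with A*, the bands are also invariant under S*:
    they reduce S. Let C = (1 + A*A)^-1, a positive contraction that commutes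
    with A. With t = 1/(1 + r^2), one has C >= t on [band A r]
    ([band_ge]) and C <= t on its orthogonal complement
    ([band_orthogonal_le]). The latter needs vectors in the band, and the
    kernel of |C - t| - (C - t) provides enough of them; here |C - t| is
    obtained by an explicit iteration ([abs_exists]). So for a fine grid of
    values of t, the space splits into orthogonal pieces that reduce S and on
    which C is almost a scalar. Hence the commutator of S and C is arbitrarily
    small, so it vanishes ([resolvent_commutes]), and SA* ⊂ A*S follows by
    a short computation.

    The product. As B is normal, U = B*S is an isometry with S*U = S and
    US* = S, and the commutation of S and S* with A passes to U. Put T = AB.
    If T*T x = v and w = Bx, then testing T* on the vectors S p, with p in the
    domain of A, gives A*A w = S* v. So AA*w = S* v, and the vector k = U A* w
    satisfies k = T* x and A k = U S* v = S v, that is, T k = v. Hence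
    T*T ⊂ TT* ([product_sub]), and for a closed T this inclusion is already
    an equality ([normal_of_sub]).

    Only the real part of the inner product is used: over the real numbers,
    inequalities can be left to decision procedures, and orthogonality and
    adjointness for a complex-linear operator are the same as for the complex
    inner product ([adjoint_atE]). The functional-analytic background is built
    from the projection theorem in H x H ([projection_exists]), which is
    applied mostly to graphs ([graph_projection]). *)

Set Implicit Arguments.
Unset Strict Implicit.
Unset Printing Implicit Defensive.

Import Order.TTheory GRing.Theory Num.Theory.
Import numFieldNormedType.Exports.

Local Open Scope classical_set_scope.
Local Open Scope ring_scope.
Local Open Scope complex_scope.

(** * The real inner product and its norm *)

Section RealInner.
Context {R : realType} {H : hilbertType R}.
Implicit Types (x y z : H) (a b c : R).

Definition rdot x y : R := complex.Re (inner x y).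
Definition sq x : R := rdot x x.
Definition nrm x : R := Num.sqrt (sq x).

Lemma rdotDl x y z : rdot (x + y) z = rdot x z + rdot y z.
Proof. by rewrite /rdot linearDl raddfD. Qed.

Lemma innerC x y : inner y x = (inner x y)^*.
Proof. by rewrite (hermitian_subproof y x) expr0 mul1r. Qed.

Lemma rdotC x y : rdot x y = rdot y x.
Proof. by rewrite /rdot (innerC x y); case: (inner x y). Qed.

Lemma rdotDr x y z : rdot z (x + y) = rdot z x + rdot z y.
Proof. by rewrite !(rdotC z) rdotDl. Qed.

Lemma rdotZl c x y : rdot (c%:C *: x) y = c * rdot x y.
Proof.
by rewrite /rdot linearZl_LR/=; case: (inner x y) => u v /=; rewrite mul0r subr0.
Qed.

Lemma rdotZr c x y : rdot x (c%:C *: y) = c * rdot x y.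
Proof. by rewrite rdotC rdotZl rdotC. Qed.

Lemma rdotNl x y : rdot (- x) y = - rdot x y.
Proof. by rewrite /rdot linearNl raddfN. Qed.

Lemma rdotNr x y : rdot x (- y) = - rdot x y.
Proof. by rewrite rdotC rdotNl rdotC. Qed.

Lemma rdot0l x : rdot 0 x = 0.
Proof. by rewrite /rdot linear0l. Qed.

Lemma rdot0r x : rdot x 0 = 0.
Proof. by rewrite rdotC rdot0l. Qed.

Definition rdotE :=
  (rdotDl, rdotDr, rdotNl, rdotNr, rdotZl, rdotZr, rdot0l, rdot0r).

Lemma norm_sq x : `|x| ^+ 2 = (sq x)%:C.
Proof.
rewrite /sq /rdot -innerE.
have : `|x| ^+ 2 \is Num.real by rewrite rpredX// normr_real.
by move=> /RRe_real ->.
Qed.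

Lemma sq_ge0 x : 0 <= sq x.
Proof. by rewrite -lecR -norm_sq exprn_ge0. Qed.

Lemma normE x : `|x| = (nrm x)%:C.
Proof.
apply/eqP; rewrite -(@eqrXn2 _ 2)//; last by rewrite ler0c sqrtr_ge0.
by rewrite norm_sq -rmorphXn/= sqr_sqrtr ?sq_ge0.
Qed.

Lemma nrm_ge0 x : 0 <= nrm x.
Proof. exact: sqrtr_ge0. Qed.

Lemma nrm_sq x : nrm x ^+ 2 = sq x.
Proof. by rewrite sqr_sqrtr// sq_ge0. Qed.

Lemma nrm_eq0 x : nrm x = 0 -> x = 0.
Proof. by move=> x0; apply/eqP; rewrite -normr_eq0 normE x0. Qed.

Lemma sq_eq0 x : sq x = 0 -> x = 0.
Proof. by move=> x0; apply: nrm_eq0; rewrite /nrm x0 sqrtr0. Qed.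

Lemma sq_le0 x : sq x <= 0 -> x = 0.
Proof. by move=> h; apply: sq_eq0; have := sq_ge0 x; lra. Qed.

Lemma nrmD x y : nrm (x + y) <= nrm x + nrm y.
Proof. by rewrite -lecR rmorphD/= -!normE ler_normD. Qed.

Lemma nrmN x : nrm (- x) = nrm x.
Proof. by rewrite /nrm /sq !rdotE opprK. Qed.

Lemma nrmBC x y : nrm (x - y) = nrm (y - x).
Proof. by rewrite -nrmN opprB. Qed.

Lemma nrmZ c x : nrm (c%:C *: x) = `|c| * nrm x.
Proof. by rewrite /nrm /sq !rdotE mulrA sqrtrM ?sqr_ge0// -expr2 sqrtr_sqr. Qed.

Lemma nrm0 : nrm 0 = 0.
Proof. by rewrite /nrm /sq rdot0l sqrtr0. Qed.

Lemma nrmB_triangle x y z : nrm (x - z) <= nrm (x - y) + nrm (y - z).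
Proof. by rewrite -{1}(subrK y x) -addrA nrmD. Qed.

(** Vector identities are proved by testing against every vector, which turns
    them into identities in [R]. *)
Lemma rdot_inj x y : (forall z, rdot x z = rdot y z) -> x = y.
Proof.
move=> xy; apply/eqP; rewrite -subr_eq0; apply/eqP/sq_eq0.
by rewrite /sq rdotDl rdotNl xy subrr.
Qed.

End RealInner.

Ltac vec := apply: rdot_inj => ?; rewrite !rdotE; by [ring|lra|field].

Section CauchySchwarz.
Context {R : realType} {H : hilbertType R}.
Implicit Types (x y z : H) (a b c : R).

(** A quadratic polynomial that never becomes negative has a nonpositive
    discriminant: the abstract form of Cauchy-Schwarz. *)
Lemma discr_le a b c :
  (forall t, 0 <= a + 2 * t * b + t ^+ 2 * c) -> b ^+ 2 <= a * c.
Proof.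
move=> h.
have [c0|c0] := leP c 0.
  have [b0|b0] := eqVneq b 0.
    subst b; have a0 : 0 <= a by have := h 0; lra.
    have [->|cn0] := eqVneq c 0; first by rewrite expr0n mulr0.
    have cl : c < 0 by rewrite lt_neqAle cn0.
    (* for large t the quadratic term wins *)
    have := h ((a + 1) / - c + 1).
    have : (a + 1) / - c * c = - (a + 1) by field.
    have : 0 <= (a + 1) / - c by apply: divr_ge0; lra.
    set q := _ / - c => q0 e ht.
    have e2 : q ^+ 2 * c = - (a + 1) * q by rewrite expr2 -mulrA e mulrC.
    have : 0 <= (a + 1) * q by apply: mulr_ge0; lra.
    by nra.
  have e : (a + 1) / (- 2 * b) * b = - (a + 1) / 2 by field.
  have := h ((a + 1) / (- 2 * b)).
  set s := (a + 1) / _ in e *.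
  have : s ^+ 2 * c <= 0 by rewrite mulr_ge0_le0// sqr_ge0.
  nra.
have e : b / c * c = b by rewrite divfK// gt_eqF.
have := h (- (b / c)); set s := b / c in e *.
rewrite -e => hs; nra.
Qed.

Lemma cauchy_schwarz x y : rdot x y ^+ 2 <= sq x * sq y.
Proof.
apply: discr_le => t; have := sq_ge0 (x + t%:C *: y).
by rewrite /sq !rdotE (rdotC y x) => h; nra.
Qed.

Lemma rdot_le x y : `|rdot x y| <= nrm x * nrm y.
Proof.
rewrite -(ler_pXn2r (_ : 0 < 2)%N) ?nnegrE ?mulr_ge0 ?nrm_ge0//.
by rewrite real_normK ?num_real// exprMn !nrm_sq cauchy_schwarz.
Qed.

(** [inner x y] is recovered from the real inner product as
    [rdot x y + i * rdot x (i y)], so real orthogonality to a complex subspace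
    is complex orthogonality. *)
Lemma inner_rdot x y : inner x y = (rdot x y) +i* (- rdot ('i *: x) y).
Proof.
rewrite /rdot linearZl_LR/=; case: (inner x y) => u v /=.
by rewrite mul0r mul1r sub0r opprK.
Qed.

Lemma adjoint_atE (T : operator H) y z :
  adjoint_at T y z <-> forall x, dom T x -> rdot (T x) y = rdot x z.
Proof.
split=> [h x /h|h x Tx]; first by rewrite /rdot => ->.
have Tix : dom T ('i *: x) by rewrite -[_ *: x]addr0; exact: domP (dom0 T).
rewrite !inner_rdot h//; congr (_ +i* - _); rewrite -h//; congr rdot.
by have := Defs.appP 'i Tx (dom0 T); rewrite !addr0 app0 addr0 => ->.
Qed.

Lemma complete_seq (u : nat -> H) :
  (forall d, 0 < d -> exists N, forall m n, (N <= m)%N -> (N <= n)%N ->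
     nrm (u m - u n) < d) ->
  exists l, forall d, 0 < d -> exists N, forall n, (N <= n)%N ->
     nrm (u n - l) < d.
Proof.
move=> hu.
have /cauchy_cvgP cu : cauchy (u @ \oo).
  apply: cauchy_exP => e e0.
  have er : e = (complex.Re e)%:C by rewrite RRe_real// gtr0_real.
  have r0 : 0 < complex.Re e by rewrite -ltcR -er.
  have [N hN] := hu _ r0.
  exists (u N), N => // n /= Nn.
  by rewrite -ball_normE /ball_/= normE er ltcR; exact: hN.
exists (lim (u @ \oo)) => d d0.
move/cvgrPdist_lt: cu => /(_ d%:C); rewrite ltcR => /(_ d0) [N _ hN].
exists N => n Nn; have := hN n Nn; rewrite /= normE ltcR.
by rewrite nrmBC.
Qed.

(** Adherence for the Hilbert norm of H x H. Subsets of H x H are represented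
    by relations, because the norm of the product type is not hilbertian. *)
Definition adherent (G : H -> H -> Prop) x y := forall d, 0 < d ->
  exists u v, [/\ G u v, nrm (x - u) < d & nrm (y - v) < d].

Lemma closed_opP (T : operator H) : closed_op T <->
  forall x y, adherent (fun u v => dom T u /\ v = T u) x y ->
    dom T x /\ y = T x.
Proof.
split=> [cT x y xy|h].
  apply: (cT (x, y)) => B [] /= [U V] [/= nU nV] UVB.
  move/nbhs_ballP : nU => [e /= e0 eU].
  move/nbhs_ballP : nV => [e' /= e0' eV].
  have er : e = (complex.Re e)%:C by rewrite RRe_real// gtr0_real.
  have er' : e' = (complex.Re e')%:C by rewrite RRe_real// gtr0_real.
  have r0 : 0 < complex.Re e by rewrite -ltcR -er.
  have r0' : 0 < complex.Re e' by rewrite -ltcR -er'.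
  have [|a [b [[Ta ->] ha hb]]] := xy (Num.min (complex.Re e) (complex.Re e')).
    by rewrite lt_min r0.
  exists (a, T a); split => //; apply: UVB; split => /=.
    apply: eU; rewrite -ball_normE /ball_/= normE er ltcR.
    by rewrite (lt_le_trans ha)// ge_min lexx.
  apply: eV; rewrite -ball_normE /ball_/= normE er' ltcR.
  by rewrite (lt_le_trans hb)// ge_min lexx orbT.
move=> [x y] xy; apply: h => d d0.
have dC : 0 < d%:C by rewrite ltcR.
have [|[a b] [/= [Ta ->] [/= ha hb]]] := xy (ball (x, y) d%:C).
  exact: nbhsx_ballx.
exists a, (T a); split => //.
  by move: ha; rewrite -ball_normE /ball_/= normE ltcR.
by move: hb; rewrite -ball_normE /ball_/= normE ltcR.
Qed.

Lemma dense_nrm (D : set H) : dense D <->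
  forall x d, 0 < d -> exists2 u, D u & nrm (x - u) < d.
Proof.
split=> [dD x d d0|h U [x Ux] oU].
  have dC : 0 < d%:C by rewrite ltcR.
  have [|a [xa Da]] := dD (ball x d%:C) _ (ball_open _ _).
    by exists x; exact: ballxx.
  by exists a => //; move: xa; rewrite -ball_normE /ball_/= normE ltcR.
move: oU; rewrite openE => /(_ _ Ux) /nbhs_ballP [e /= e0 eU].
have er : e = (complex.Re e)%:C by rewrite RRe_real// gtr0_real.
have r0 : 0 < complex.Re e by rewrite -ltcR -er.
have [a Da xa] := h x _ r0; exists a; split => //; apply: eU.
by rewrite -ball_normE /ball_/= normE er ltcR.
Qed.

End CauchySchwarz.

(** * The projection theorem in H x H *)

Section Projection.
Context {R : realType} {H : hilbertType R}.
Implicit Types (x y z u v w a b : H) (c d e : R).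

Lemma natSinv_small d : 0 < d ->
  exists N, forall n, (N <= n)%N -> n.+1%:R^-1 < d.
Proof. by move=> d0; have [N _ hN] := near_infty_natSinv_lt (PosNum d0); exists N. Qed.

Lemma small_eq0 (a b : R) : (forall d, 0 < d -> `|a| <= d * b) -> a = 0.
Proof.
move=> h; apply/eqP; rewrite -normr_le0 leNgt; apply/negP => a0.
have := h _ (ltr01); rewrite mul1r => ab.
have b0 : 0 < b by lra.
have : 0 < `|a| / (2 * b) by apply: divr_gt0 => //; lra.
move/h.
have -> : `|a| / (2 * b) * b = `|a| / 2 by field; lra.
lra.
Qed.

Lemma nrm_lt x d : 0 < d -> sq x < d ^+ 2 -> nrm x < d.
Proof.
by move=> d0; rewrite -nrm_sq ltr_pXn2r// nnegrE ?nrm_ge0// ltW.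
Qed.

Lemma nrm_le x d : 0 <= d -> sq x <= d ^+ 2 -> nrm x <= d.
Proof. by move=> d0; rewrite -nrm_sq ler_pXn2r// nnegrE ?nrm_ge0. Qed.

Definition real_sub (G : H -> H -> Prop) := G 0 0 /\
  forall c x y x' y', G x y -> G x' y' -> G (c%:C *: x + x') (c%:C *: y + y').

Definition graph_closed (G : H -> H -> Prop) :=
  forall x y, adherent G x y -> G x y.

Section Minimizer.
Variables (G : H -> H -> Prop) (G0 : real_sub G) (u v : H).

Let dist x y := sq (u - x) + sq (v - y).
Let D : set R := [set r | exists x y, G x y /\ r = dist x y].

Let D_inf : has_inf D.
Proof.
split; first by exists (dist 0 0), 0, 0; split => //; have [] := G0.
by exists 0 => _ [x [y [_ ->]]]; rewrite addr_ge0// sq_ge0.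
Qed.

(** If (x, y) nearly minimizes the distance from G to (u, v), then moving along
    a direction of G cannot gain more than e. Applied to the difference of two
    such points, this also makes minimizing sequences Cauchy. *)
Lemma almost_orthogonal e x y a b : G x y -> dist x y < inf D + e -> G a b ->
  (rdot (u - x) a + rdot (v - y) b) ^+ 2 <= e * (sq a + sq b).
Proof.
move=> Gxy xy_min Gab; rewrite -sqrrN; apply: discr_le => t.
have Gt : G (t%:C *: a + x) (t%:C *: b + y) by have [_] := G0; apply.
have : inf D <= dist (t%:C *: a + x) (t%:C *: b + y).
  by apply: ge_inf; [case: D_inf|do 2 eexists; split; first exact: Gt].
move: xy_min; rewrite /dist /sq !rdotE.
rewrite ?(rdotC a) ?(rdotC b) ?(rdotC x u) ?(rdotC y v) => h1 h2; nra.
Qed.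

Lemma projection_exists : graph_closed G ->
  exists x y, G x y /\
    forall a b, G a b -> rdot (u - x) a + rdot (v - y) b = 0.
Proof.
move=> cG.
pose e n : R := n.+1%:R^-1.
have e0 n : 0 < e n by rewrite invr_gt0.
have /choice [p hp] : forall n, exists p : H * H,
    G p.1 p.2 /\ dist p.1 p.2 < inf D + e n.
  by move=> n; have [_ [x [y [Gxy ->]]] h] := inf_adherent (e0 n) D_inf;
    exists (x, y).
have step m n : sq ((p m).1 - (p n).1) + sq ((p m).2 - (p n).2)
    <= 2 * (e m + e n).
  have [[Gm hm] [Gn hn]] := (hp m, hp n).
  have Gmn : G ((p m).1 - (p n).1) ((p m).2 - (p n).2).
    have [_ /(_ (-1) _ _ _ _ Gn Gm)] := G0.
    by rewrite rmorphN rmorph1 !scaleN1r ![- _ + _]addrC.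
  have := almost_orthogonal Gm hm Gmn; have := almost_orthogonal Gn hn Gmn.
  set r := (X in X ^+ 2 <= _) => hr; set s := (X in X ^+ 2 <= _) => hs.
  have : sq ((p m).1 - (p n).1) + sq ((p m).2 - (p n).2) = r - s.
    by rewrite /r /s /sq !rdotE; ring.
  set c := (X in X = _ -> _) => cE; rewrite -/c in hr hs |- *.
  have c0 : 0 <= c by rewrite addr_ge0// sq_ge0.
  have : c ^+ 2 <= 2 * (e m + e n) * c.
    suff : (r - s) ^+ 2 <= 2 * (e m + e n) * c by rewrite -cE.
    have := sqr_ge0 (r + s). lra.
  have [->|cn0] := eqVneq c 0; first by have := e0 m; have := e0 n; lra.
  by rewrite expr2 ler_pM2r// lt_neqAle eq_sym cn0.
have small d : 0 < d -> exists N, forall m n, (N <= m)%N -> (N <= n)%N ->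
    2 * (e m + e n) < d ^+ 2.
  move=> d0; have [|N hN] := @natSinv_small (d ^+ 2 / 4).
    by rewrite divr_gt0// exprn_gt0.
  exists N => m n /hN hm /hN hn.
  have : e m + e n < d ^+ 2 / 4 + d ^+ 2 / 4 by apply: ltrD.
  lra.
have [x hx] : exists x, forall d, 0 < d -> exists N, forall n, (N <= n)%N ->
    nrm ((p n).1 - x) < d.
  apply: complete_seq => d d0; have [N hN] := small _ d0.
  exists N => m n Nm Nn; apply: nrm_lt => //.
  have := step m n; have := hN _ _ Nm Nn.
  by have := sq_ge0 ((p m).2 - (p n).2); lra.
have [y hy] : exists y, forall d, 0 < d -> exists N, forall n, (N <= n)%N ->
    nrm ((p n).2 - y) < d.
  apply: complete_seq => d d0; have [N hN] := small _ d0.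
  exists N => m n Nm Nn; apply: nrm_lt => //.
  have := step m n; have := hN _ _ Nm Nn.
  by have := sq_ge0 ((p m).1 - (p n).1); lra.
have lim d : 0 < d -> exists n,
    [/\ nrm ((p n).1 - x) < d, nrm ((p n).2 - y) < d & e n < d ^+ 2].
  move=> d0; have [N1 h1] := hx _ d0; have [N2 h2] := hy _ d0.
  have [|N3 h3] := @natSinv_small (d ^+ 2); first by rewrite exprn_gt0.
  exists (N1 + N2 + N3)%N; split; [apply: h1|apply: h2|apply: h3].
  - by rewrite -addnA leq_addr.
  - by rewrite addnAC leq_addl.
  - by rewrite leq_addl.
exists x, y; split.
  apply: cG => d /lim [n [h1 h2 _]]; have [Gn _] := hp n.
  by exists (p n).1, (p n).2; split => //; rewrite nrmBC.
move=> a b Gab.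
apply: (@small_eq0 _ (nrm a + nrm b + Num.sqrt (sq a + sq b))) => d d0.
have [n [h1 h2 h3]] := lim _ d0; have [Gn hn] := hp n.
have c0 : 0 <= sq a + sq b by rewrite addr_ge0// sq_ge0.
have -> : rdot (u - x) a + rdot (v - y) b =
    rdot ((p n).1 - x) a + rdot ((p n).2 - y) b
    + (rdot (u - (p n).1) a + rdot (v - (p n).2) b) by rewrite !rdotE; ring.
rewrite !mulrDr (le_trans (ler_normD _ _))// lerD//.
  rewrite (le_trans (ler_normD _ _))// lerD// (le_trans (rdot_le _ _))//.
    by rewrite ler_wpM2r ?nrm_ge0// ltW.
  by rewrite ler_wpM2r ?nrm_ge0// ltW.
rewrite -(ler_pXn2r (_ : 0 < 2)%N) ?nnegrE ?mulr_ge0 ?sqrtr_ge0 ?(ltW d0)//.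
rewrite real_normK ?num_real// exprMn sqr_sqrtr//.
rewrite (le_trans (almost_orthogonal Gn hn Gab))//.
by rewrite ler_wpM2r// ltW.
Qed.

End Minimizer.

End Projection.

(** * Closed subspaces, Riesz representation and bounded adjoints *)

Section Subspaces.
Context {R : realType} {H : hilbertType R}.
Implicit Types (x y z u v w a b : H) (c d e : R) (G : H -> H -> Prop) (X : set H).

Lemma adherent_sub G : real_sub G -> real_sub (adherent G).
Proof.
move=> [G0 GP]; split.
  by move=> d d0; exists 0, 0; rewrite !subr0 nrm0.
move=> c x y x' y' h h' d d0.
have [q q0 cq] : exists2 q, 0 < q & `|c| * q <= d / 2.
  have c1 : 0 < `|c| + 1 by rewrite ltr_wpDl.
  exists (d / (`|c| + 1) / 2); first by rewrite !divr_gt0.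
  have e1 : (d / (`|c| + 1) / 2) * (`|c| + 1) = d / 2 by field; lra.
  have : 0 < d / (`|c| + 1) / 2 by rewrite !divr_gt0.
  lra.
have [a [b [Gab ha hb]]] := h _ q0.
have [a' [b' [Gab' ha' hb']]] := h' (d / 2) (divr_gt0 d0 (ltr0n _ 2)).
exists (c%:C *: a + a'), (c%:C *: b + b'); split; first exact: GP.
  have -> : c%:C *: x + x' - (c%:C *: a + a') = c%:C *: (x - a) + (x' - a').
    by vec.
  rewrite (le_lt_trans (nrmD _ _))// nrmZ.
  have : `|c| * nrm (x - a) <= `|c| * q.
    by rewrite ler_wpM2l// ltW.
  lra.
have -> : c%:C *: y + y' - (c%:C *: b + b') = c%:C *: (y - b) + (y' - b').
  by vec.
rewrite (le_lt_trans (nrmD _ _))// nrmZ.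
have : `|c| * nrm (y - b) <= `|c| * q.
  by rewrite ler_wpM2l// ltW.
lra.
Qed.

Lemma adherent_closed G : graph_closed (adherent G).
Proof.
move=> x y h d d0; have d20 : 0 < d / 2 by lra.
have [u [v [/(_ _ d20) [a [b [Gab ua vb]]] xu yv]]] := h _ d20.
exists a, b; split => //; rewrite [ltRHS](splitr d).
  by rewrite (le_lt_trans (nrmB_triangle _ u _))// ltrD.
by rewrite (le_lt_trans (nrmB_triangle _ v _))// ltrD.
Qed.

Lemma subset_adherent G x y : G x y -> adherent G x y.
Proof. by move=> Gxy d d0; exists x, y; rewrite !subrr nrm0. Qed.

Definition adh X : set H :=
  [set x | forall d, 0 < d -> exists2 a, X a & nrm (x - a) < d].

Definition real_subspace X := X 0 /\
  forall c x y, X x -> X y -> X (c%:C *: x + y).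

Lemma subspaceB X x y : real_subspace X -> X x -> X y -> X (x - y).
Proof.
move=> [_ XP] Xx Xy; have := XP (-1) _ _ Xy Xx.
by rewrite rmorphN rmorph1 scaleN1r addrC.
Qed.

Let line X x y := X x /\ y = 0.

Let line_sub X : real_subspace X -> real_sub (line X).
Proof.
move=> [X0 XP]; split=> // c x y x' y' [Xx ->] [Xx' ->].
by split; [exact: XP|rewrite scaler0 addr0].
Qed.

Let adh_line X x : adh X x -> adherent (line X) x 0.
Proof.
by move=> h d d0; have [a Xa xa] := h _ d0; exists a, 0; split; rewrite ?subr0 ?nrm0.
Qed.

Let line_adh X x y : adherent (line X) x y -> adh X x.
Proof. by move=> h d /h [a [b [[Xa _] xa _]]]; exists a. Qed.

Lemma adh_real_subspace X : real_subspace X -> real_subspace (adh X).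
Proof.
move=> sX; have [h0 hP] := adherent_sub (line_sub sX).
split; first exact: line_adh h0.
move=> c x y /adh_line hx /adh_line hy; apply: line_adh (hP c _ _ _ _ hx hy).
Qed.

Lemma adh_closed X : adh (adh X) `<=` adh X.
Proof.
move=> x /adh_line h; apply: (@line_adh _ _ 0); apply: adherent_closed => d /h.
move=> [a [b [[/adh_line Xa ->]]]] xa b0.
by exists a, 0.
Qed.

Lemma subset_adh X : X `<=` adh X.
Proof. by move=> x Xx d d0; exists x; rewrite ?subrr ?nrm0. Qed.

Lemma projection X : real_subspace X -> adh X `<=` X -> forall u,
  exists2 p, X p & forall a, X a -> rdot (u - p) a = 0.
Proof.
move=> sX cX u.
have [|p [q [[Xp q0] h]]] := @projection_exists _ _ (line X) (line_sub sX) u 0.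
  move=> x y h; split; first exact/cX/(line_adh h).
  apply: nrm_eq0; apply: (@small_eq0 _ _ 1) => d /h [a [b [[_ ->]]]].
  by rewrite subr0 ger0_norm ?nrm_ge0// mulr1 => _ /ltW.
by exists p => // a Xa; have := h a 0 (conj Xa erefl); rewrite rdot0r addr0.
Qed.

Lemma adh_orthogonal X x : (forall a, X a -> rdot x a = 0) ->
  forall a, adh X a -> rdot x a = 0.
Proof.
move=> h a ha; apply: (@small_eq0 _ _ (nrm x)) => d /ha [b Xb ab].
have -> : rdot x a = rdot x (a - b) by rewrite rdotDr rdotNr (h b)// oppr0 addr0.
by rewrite (le_trans (rdot_le _ _))// mulrC ler_wpM2r ?nrm_ge0// ltW.
Qed.

(** Linearity follows from this relation: see [adjoint_funs_linear]. *)
Definition adjoint_funs (f f' : H -> H) :=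
  forall x y, rdot (f x) y = rdot x (f' y).

Definition real_linear (f : H -> H) :=
  forall c x y, f (c%:C *: x + y) = c%:C *: f x + f y.

Definition bounded_by (M : R) (f : H -> H) := forall x, nrm (f x) <= M * nrm x.

Lemma adjoint_funsC f f' : adjoint_funs f f' -> adjoint_funs f' f.
Proof. by move=> h x y; rewrite rdotC -h rdotC. Qed.

Lemma adjoint_funs_linear f f' : adjoint_funs f f' -> real_linear f.
Proof. by move=> h c x y; apply: rdot_inj => z; rewrite !(rdotE, h). Qed.

Section RealLinear.
Variables (f : H -> H) (fl : real_linear f).

Lemma rlin0 : f 0 = 0.
Proof.
have := fl (-1) 0 0; rewrite rmorphN rmorph1 scaler0 addr0 => ->.
by rewrite scaleN1r addNr.
Qed.

Lemma rlinD x y : f (x + y) = f x + f y.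
Proof. by have := fl 1 x y; rewrite rmorph1 !scale1r. Qed.

Lemma rlinZ c x : f (c%:C *: x) = c%:C *: f x.
Proof. by have := fl c x 0; rewrite !addr0 rlin0 addr0. Qed.

Lemma rlinB x y : f (x - y) = f x - f y.
Proof.
have := fl (-1) y x; rewrite rmorphN rmorph1 !scaleN1r ![- _ + _]addrC.
exact.
Qed.

End RealLinear.

(** A representing vector is found on the line orthogonal to the kernel. *)
Lemma riesz (f : H -> R) M : (forall c x y, f (c%:C *: x + y) = c * f x + f y) ->
  (forall x, `|f x| <= M * nrm x) -> exists z, forall x, f x = rdot x z.
Proof.
move=> fl fM; have f0 : f 0 = 0.
  by have := fl 1 0 0; rewrite scaler0 addr0; lra.
have fB x y : f (x - y) = f x - f y.
  by have := fl (-1) y x; rewrite rmorphN rmorph1 scaleN1r addrC => ->; ring.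
pose K : set H := [set x | f x = 0].
have sK : real_subspace K.
  by split => // c x y /= fx fy; rewrite /K/= fl fx fy mulr0 addr0.
have cK : adh K `<=` K.
  move=> x h; apply: (@small_eq0 _ _ `|M|) => d /h [a fa xa].
  have -> : f x = f (x - a) by rewrite fB fa subr0.
  rewrite (le_trans (fM _))//.
  rewrite (@le_trans _ _ (`|M| * nrm (x - a)))//.
    by rewrite ler_wpM2r ?nrm_ge0// ler_norm.
  by rewrite mulrC ler_wpM2r// ltW.
have [fK|/existsNP [e fe]] := pselect (forall x, f x = 0).
  by exists 0 => x; rewrite rdot0r.
have [p Kp hp] := projection sK cK e.
have fg : f (e - p) = f e by rewrite fB Kp subr0.
move: (e - p) hp fg => g hp fg.
have g0 : sq g != 0.
  by apply/eqP => /sq_eq0 g0; apply: fe; rewrite -fg g0.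
exists ((f e / sq g)%:C *: g) => x; rewrite rdotZr.
have : K (x - (f x / f e)%:C *: g).
  rewrite /K/= fB -[_ *: g]addr0 fl f0 addr0 fg divfK ?subrr//.
  exact/eqP.
move/hp; rewrite !rdotE -/(sq g) rdotC => /eqP.
rewrite subr_eq0 => /eqP ->.
by field; rewrite g0 andbT; exact/eqP.
Qed.

Lemma adjoint_exists f M : real_linear f -> bounded_by M f ->
  exists f', adjoint_funs f f'.
Proof.
move=> fl fM.
suff /choice [f' hf'] : forall y, exists z, forall x, rdot (f x) y = rdot x z.
  by exists f' => x y.
move=> y; apply: (@riesz _ (M * nrm y)) => [c x x'|x].
  by rewrite fl !rdotE.
by rewrite (le_trans (rdot_le _ _))// mulrAC ler_wpM2r ?nrm_ge0.
Qed.

End Subspaces.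

(** * Closed operators and their adjoints *)

Section Operators.
Context {R : realType} {H : hilbertType R}.
Implicit Types (x y z u v w a b : H) (c d e : R) (T A : operator H).

Lemma domD T x y : dom T x -> dom T y -> dom T (x + y).
Proof. by move=> Tx Ty; have := domP 1 Tx Ty; rewrite scale1r. Qed.

Lemma domN T x : dom T x -> dom T (- x).
Proof. by move=> Tx; have := domP (-1) Tx (dom0 T); rewrite addr0 scaleN1r. Qed.

Lemma domB T x y : dom T x -> dom T y -> dom T (x - y).
Proof. by move=> Tx /domN; exact: domD. Qed.

Lemma appD T x y : dom T x -> dom T y -> T (x + y) = T x + T y.
Proof. by move=> Tx Ty; have := Defs.appP 1 Tx Ty; rewrite !scale1r. Qed.

Lemma appN T x : dom T x -> T (- x) = - T x.
Proof.
move=> Tx; have := Defs.appP (-1) Tx (dom0 T).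
by rewrite app0 !addr0 !scaleN1r.
Qed.

Lemma appB T x y : dom T x -> dom T y -> T (x - y) = T x - T y.
Proof. by move=> Tx Ty; rewrite appD ?appN//; exact: domN. Qed.

(** The real form of [adjoint_at]; see [adjoint_atE]. *)
Definition adjr T y z := forall x, dom T x -> rdot (T x) y = rdot x z.

Definition graph T x y := dom T x /\ y = T x.

Lemma graph_sub T : real_sub (graph T).
Proof.
split; first by split; [exact: dom0|rewrite app0].
move=> c x y x' y' [Tx ->] [Tx' ->]; split; first exact: domP.
by rewrite Defs.appP.
Qed.

(** Projecting (u, v) onto the graph of a closed operator; the residual
    (u - x, v - T x) lies in the rotated graph of the adjoint. *)
Lemma graph_projection T : graph_closed (graph T) -> forall u v,
  exists2 x, dom T x & adjr T (v - T x) (x - u).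
Proof.
move=> cT u v; have [x [y [[Tx ->] h]]] := projection_exists (graph_sub T) u v cT.
exists x => // z Tz; have := h z (T z) (conj Tz erefl).
by rewrite !rdotE !(rdotC z) !(rdotC (T z)); lra.
Qed.

Lemma adjr_closed T x y : adherent (adjr T) x y -> adjr T x y.
Proof.
move=> h z Tz; apply/eqP; rewrite -subr_eq0; apply/eqP.
apply: (@small_eq0 _ _ (nrm (T z) + nrm z)) => d /h [a [b [hab ha hb]]].
have -> : rdot (T z) x - rdot z y = rdot (T z) (x - a) - rdot z (y - b).
  by rewrite !rdotE (hab z Tz); ring.
rewrite (le_trans (ler_normB _ _))// mulrDr lerD// (le_trans (rdot_le _ _))//.
  by rewrite mulrC ler_wpM2r ?nrm_ge0// ltW.
by rewrite mulrC ler_wpM2r ?nrm_ge0// ltW.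
Qed.

(** This presentation of a normal operator A, with A' = A*, is symmetric in A
    and A', so every statement proved about A also holds for A'. *)
Record normal_pair (A A' : operator H) : Prop := NormalPair {
  np_adj : forall y z, adjr A y z <-> dom A' y /\ A' y = z ;
  np_adj' : forall y z, adjr A' y z <-> dom A y /\ A y = z ;
  np_comm : forall x, dom A x /\ dom A' (A x) <-> dom A' x /\ dom A (A' x) ;
  np_commE : forall x, dom A x -> dom A' (A x) -> A' (A x) = A (A' x) }.

Lemma normal_pairC (A A' : operator H) : normal_pair A A' -> normal_pair A' A.
Proof.
case=> h h' c cE; split=> // x; first by split=> /c.
by move=> A'x AA'x; have [//|Ax A'Ax] := (c x).2; rewrite cE.
Qed.

(** A closed operator is the adjoint of its adjoint: the residual of the
    projection of (y, z) onto the graph vanishes when it is tested against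
    itself. *)
Lemma adjoint_adjoint T : graph_closed (graph T) -> forall y z,
  (forall u v, adjr T u v -> rdot v y = rdot u z) -> dom T y /\ T y = z.
Proof.
move=> cT y z h; have [x Tx hx] := graph_projection cT y z.
have h1 := h _ _ hx; have h2 := hx _ Tx.
have s : sq (x - y) + sq (z - T x) = 0.
  move: h1 h2; rewrite /sq !rdotE (rdotC y x) (rdotC z (T x)); lra.
have := sq_ge0 (x - y); have := sq_ge0 (z - T x) => s1 s2.
have /eqP : x - y = 0 by apply: sq_eq0; lra.
have /eqP : z - T x = 0 by apply: sq_eq0; lra.
by rewrite !subr_eq0 => /eqP -> /eqP <-.
Qed.

Lemma op_adjointE T (dT : densely_defined T) y z :
  adjr T y z <-> dom (op_adjoint dT) y /\ op_adjoint dT y = z.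
Proof.
split=> [/adjoint_atE h|[[z' h] <-]].
  by split; [exists z|exact: adjoint_appE].
by rewrite /= (adjoint_appE dT h); apply/adjoint_atE.
Qed.

Lemma normal_op_pair A : normal_op A -> exists A', normal_pair A A'.
Proof.
move=> [dA [cA [AAdom AAE]]]; exists (op_adjoint dA); split.
- exact: op_adjointE.
- move=> y z; split.
    move=> h; apply: adjoint_adjoint; first exact/closed_opP.
    by move=> u v /op_adjointE [A'u <-]; exact: h.
  move=> [Ay <-] x A'x.
  have /op_adjointE h := conj A'x (erefl (op_adjoint dA x)).
  by rewrite rdotC -h// rdotC.
- move=> x; split=> hx.
    by have : dom (op_comp A (op_adjoint dA)) x by rewrite AAdom.
  by have : dom (op_comp (op_adjoint dA) A) x by rewrite -AAdom.
- by move=> x Ax A'Ax; rewrite [LHS](esym (AAE _ _))// AAdom.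
Qed.

Section Pair.
Variables (A A' : operator H) (nA : normal_pair A A').

Lemma np_rdot x y : dom A x -> dom A' y -> rdot (A x) y = rdot x (A' y).
Proof. by move=> Ax A'y; have /(np_adj nA) := conj A'y (erefl (A' y)); exact. Qed.

Lemma np_closed : graph_closed (graph A).
Proof.
move=> x y h; suff : adjr A' x y by move/(np_adj' nA) => [Ax <-].
apply: adjr_closed => d /h [a [b [[Aa ->] xa yb]]]; exists a, (A a); split=> //.
exact/(np_adj' nA).
Qed.

(** 1 + A'A is onto: project (u, 0) onto the graph of A. *)
Lemma np_resolvent u : exists x, [/\ dom A x, dom A' (A x) & A' (A x) = u - x].
Proof.
have [x Ax h] := graph_projection np_closed u 0; exists x.
have /(np_adj nA) [A'Ax e] : adjr A (A x) (u - x).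
  by move=> z /h; rewrite !rdotE; lra.
by [].
Qed.

Lemma np_resolvent_inj x u : dom A x -> dom A' (A x) -> A' (A x) = u - x ->
  forall x', dom A x' -> dom A' (A x') -> A' (A x') = u - x' -> x = x'.
Proof.
move=> Ax A'Ax xE x' Ax' A'Ax' x'E.
have Ad : dom A (x - x') by exact: domB.
have : rdot (A (x - x')) (A (x - x')) = rdot (x - x') (A' (A (x - x'))).
  by apply: np_rdot => //; rewrite appB//; exact: domB.
have -> : A' (A (x - x')) = - (x - x').
  rewrite !appB// xE x'E; vec.
rewrite rdotNr -/(sq _) -/(sq _) => h.
have := sq_ge0 (A (x - x')); have := sq_ge0 (x - x') => s1 s2.
by apply/eqP; rewrite -subr_eq0; apply/eqP/sq_eq0; lra.
Qed.

(** The domain of A'A is a core of A: a vector graph-orthogonal to it is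
    orthogonal to the range of 1 + A'A, which is everything. *)
Lemma np_core x : dom A x ->
  adherent (fun y z => [/\ dom A y, dom A' (A y) & z = A y]) x (A x).
Proof.
set G := (fun y z => _) => Ax.
have sG : real_sub G.
  split; first by split; rewrite ?app0//; exact: dom0.
  move=> c y z y' z' [Ay A'y ->] [Ay' A'y' ->].
  by split; rewrite ?Defs.appP//; exact: domP.
have cG : graph_closed (adherent G) by exact: adherent_closed.
have [p [q [Gpq h]]] := projection_exists (adherent_sub sG) x (A x) cG.
have [Ap qE] : graph A p q.
  apply: np_closed => d /Gpq [a [b [[Aa A'Aa ->] pa qb]]].
  by exists a, (A a).
subst q; have Axp : dom A (x - p) by exact: domB.
have [y [Ay A'Ay yE]] := np_resolvent (x - p).
have := h y (A y) (@subset_adherent _ _ G _ _ (And3 Ay A'Ay erefl)).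
rewrite -appB// np_rdot// yE -rdotDr [y + _]addrC subrK => /sq_eq0/eqP.
by rewrite subr_eq0 => /eqP ->.
Qed.

Lemma np_sq_core y : dom A y -> dom A' (A y) -> sq (A' y) = sq (A y).
Proof.
move=> Ay A'Ay; have [//|A'y AA'y] := (np_comm nA y).1.
rewrite /sq np_rdot// (np_commE nA)//.
have /(np_adj' nA) h := conj AA'y (erefl (A (A' y))).
by rewrite h.
Qed.

(** |A y| = |A' y| holds on the domain of A'A because A'A = AA', and that domain
    is a core: along a sequence of core vectors that converges to x in the graph
    norm of A, the values of A' are Cauchy too. *)
Lemma np_dom_sub x : dom A x -> dom A' x /\ sq (A' x) = sq (A x).
Proof.
move=> Ax; have hx := np_core Ax.
have /choice [y hy] : forall n, exists y, [/\ dom A y, dom A' (A y),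
    nrm (x - y) < n.+1%:R^-1 & nrm (A x - A y) < n.+1%:R^-1].
  move=> n; have [|y [_ [[Ay A'Ay ->] h1 h2]]] := hx n.+1%:R^-1.
    by rewrite invr_gt0.
  by exists y.
have A'y n : dom A' (y n).
  by have [Ay A'Ay _ _] := hy n; have [] := (np_comm nA (y n)).1 (conj Ay A'Ay).
have sqn m n : nrm (A' (y m) - A' (y n)) = nrm (A (y m) - A (y n)).
  have [[Am A'Am _ _] [An A'An _ _]] := (hy m, hy n).
  rewrite -!appB// /nrm np_sq_core//; first exact: domB.
  by rewrite appB//; exact: domB.
have [l hl] : exists l, forall d, 0 < d -> exists N, forall n, (N <= n)%N ->
    nrm (A' (y n) - l) < d.
  apply: complete_seq => d d0; have d20 : 0 < d / 2 by lra.
  have [N hN] := natSinv_small d20; exists N => m n /hN hm /hN hn.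
  have [[_ _ _ h1] [_ _ _ h2]] := (hy m, hy n).
  rewrite sqn (le_lt_trans (nrmB_triangle _ (A x) _))// nrmBC [ltRHS](splitr d).
  exact: ltrD (lt_trans h1 hm) (lt_trans h2 hn).
have h : adherent (fun u v => [/\ dom A' u, v = A' u & exists n, u = y n]) x l.
  move=> d d0; have [N1 h1] := hl _ d0; have [N2 h2] := natSinv_small d0.
  pose n := (N1 + N2)%N; exists (y n), (A' (y n)); split.
  - by split => //; exists n.
  - by have [_ _ h3 _] := hy n; rewrite (lt_trans h3)// h2// leq_addl.
  - by rewrite nrmBC h1// leq_addr.
have /(np_adj nA) [A'x A'xE] : adjr A x l.
  apply: adjr_closed => d /h [u [v [[A'u -> _] h1 h2]]].
  by exists u, (A' u); split => //; apply/(np_adj nA).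
split=> //; rewrite -!nrm_sq; congr (_ ^+ 2).
apply/eqP; rewrite -subr_eq0; apply/eqP.
apply: (@small_eq0 _ _ 2) => d d0; rewrite A'xE.
have [N1 h1] := hl _ d0; have [N2 h2] := natSinv_small d0.
have {}h1 := h1 _ (leq_addr N2 N1); have {}h2 := h2 _ (leq_addl N1 N2).
have [Ay A'Ay _ h3] := hy (N1 + N2)%N.
have e : nrm (A' (y (N1 + N2)%N)) = nrm (A (y (N1 + N2)%N)).
  by rewrite /nrm np_sq_core.
have := nrmB_triangle l (A' (y (N1 + N2)%N)) 0.
have := nrmB_triangle (A' (y (N1 + N2)%N)) l 0.
have := nrmB_triangle (A x) (A (y (N1 + N2)%N)) 0.
have := nrmB_triangle (A (y (N1 + N2)%N)) (A x) 0.
rewrite !subr0 [nrm (l - _)]nrmBC [nrm (A (y _) - _)]nrmBC e.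
have h4 := lt_trans h3 h2; rewrite ler_norml; lra.
Qed.

End Pair.

Section PairDomains.
Variables (A A' : operator H) (nA : normal_pair A A').

Lemma np_dom x : dom A x <-> dom A' x.
Proof.
by split; [move/(np_dom_sub nA) => []|move/(np_dom_sub (normal_pairC nA)) => []].
Qed.

Lemma np_sq x : dom A x -> sq (A' x) = sq (A x).
Proof. by move/(np_dom_sub nA) => []. Qed.

Lemma np_nrm x : dom A x -> nrm (A' x) = nrm (A x).
Proof. by move=> Ax; rewrite /nrm np_sq. Qed.

Lemma np_dom2 x : dom A x -> dom A (A x) -> dom A (A' x) /\ A' (A x) = A (A' x).
Proof.
move=> Ax /np_dom A'Ax; have [_ ?] := (np_comm nA x).1 (conj Ax A'Ax).
by split => //; exact: (np_commE nA).
Qed.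

End PairDomains.

End Operators.

(** * The resolvent of A*A and the growth of the powers of A *)

Section Real.
Context {R : realType}.
Implicit Types (a c q r : R) (s : nat -> R).

(** Bernoulli's inequality, cleared of denominators. *)
Lemma geometric_gap a c q r : 0 < r -> r < q -> 0 < a ->
  exists k, c * r ^+ k < a * q ^+ k.
Proof.
move=> r0 rq a0; have d0 : 0 < q - r by lra.
have bern k : r ^+ k * (r + k%:R * (q - r)) <= r * q ^+ k.
  elim: k => [|k IH]; first by rewrite !expr0; lra.
  have p0 : 0 < r ^+ k by rewrite exprn_gt0.
  have n0 : 0 <= k%:R :> R by rewrite ler0n.
  rewrite !exprS -natr1.
  have := mulr_ge0 (mulr_ge0 (ltW p0) n0) (sqr_ge0 (q - r)).
  have : q * (r ^+ k * (r + k%:R * (q - r))) <= q * (r * q ^+ k).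
    by rewrite ler_pM2l//; lra.
  by move: (r ^+ k) (q ^+ k) (k%:R) => p w n h1 h2; lra.
pose M := `|r * c / (a * (q - r))|.
have [k hk] : exists k, M < k%:R.
  by exists (Num.bound M); apply: archi_boundP; exact: normr_ge0.

exists k; have rk0 : 0 < r ^+ k by rewrite exprn_gt0.
have h1 : r * c < a * (k%:R * (q - r)).
  have : r * c / (a * (q - r)) < k%:R by rewrite (le_lt_trans (ler_norm _)).
  by rewrite ltr_pdivrMr ?mulr_gt0//; lra.
rewrite -(ltr_pM2l r0).
have h2 : a * (r ^+ k * (r + k%:R * (q - r))) <= a * (r * q ^+ k).
  by rewrite ler_pM2l.
have : 0 < r ^+ k * (a * (k%:R * (q - r)) - r * c).
  by rewrite mulr_gt0// subr_gt0.
have : 0 < r ^+ k * (a * r) by rewrite !mulr_gt0.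
by move: h2; move: (r ^+ k) (q ^+ k) (k%:R) => p w n h2 h3 h4; lra.
Qed.

(** A log-convex sequence that is O(r^k) cannot even start by growing
    faster than r. *)
Lemma log_convex_ratio s c r : (forall k, 0 <= s k) ->
  (forall k, s k.+1 ^+ 2 <= s k * s k.+2) -> 0 <= r ->
  (forall k, s k <= c * r ^+ k) -> s 1%N <= r * s 0%N.
Proof.
move=> s0 sc r0 sr; rewrite leNgt; apply/negP => h.
have s0p : 0 < s 0%N.
  rewrite lt_neqAle s0 andbT eq_sym; apply/eqP => e.
  by have := sc 0%N; have := s0 1%N; rewrite e mul0r; rewrite e mulr0 in h; nra.
pose q := s 1%N / s 0%N.
have qs : q * s 0%N = s 1%N by rewrite /q divfK// gt_eqF.
have rq : r < q by rewrite /q ltr_pdivlMr.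
have step k : 0 < s k /\ q * s k <= s k.+1.
  elim: k => [|k [sk IH]]; first by rewrite qs.
  have sk1 : 0 < s k.+1 by rewrite (lt_le_trans _ IH)// mulr_gt0//; lra.
  split => //; rewrite -(ler_pM2l sk) (le_trans _ (sc k))//.
  by rewrite mulrA [s k * _]mulrC expr2 ler_pM2r.
have sq k : s 0%N * q ^+ k <= s k.
  elim: k => [|k IH]; first by rewrite expr0 mulr1.
  have [_] := step k; apply: le_trans.
  by rewrite exprS mulrCA ler_pM2l//; lra.
have [r00|rn0] := eqVneq r 0.
  have := sr 1%N; have := sq 1%N; rewrite r00 !expr1 mulr0 => h1 h2.
  have : 0 < s 0%N * q by rewrite mulr_gt0//; lra.
  lra.
have rp : 0 < r by rewrite lt_neqAle eq_sym rn0.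
have [k hk] := geometric_gap c rp rq s0p.
by have := lt_le_trans hk (sq k); rewrite ltNge sr.
Qed.

End Real.

Section Forms.
Context {R : realType} {H : hilbertType R}.
Implicit Types (x y : H).

Lemma form_cauchy_schwarz (E : H -> H) (X : set H) x y : adjoint_funs E E ->
  real_subspace X -> (forall z, X z -> 0 <= rdot (E z) z) -> X x -> X y ->
  rdot (E x) y ^+ 2 <= rdot (E x) x * rdot (E y) y.
Proof.
move=> sE [_ XP] E0 Xx Xy; apply: discr_le => t.
have := E0 _ (XP t _ _ Xy Xx); rewrite (adjoint_funs_linear sE) !rdotE.
by rewrite (sE y x) (rdotC y) => h; nra.
Qed.

End Forms.

Section Resolvent.
Context {R : realType} {H : hilbertType R}.
Variables (A A' : operator H) (nA : normal_pair A A').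
Implicit Types (x y z u v w : H) (c d r M : R) (L : H -> H).

(** The equation C u + A'A C u = u says that C = (1 + A'A)^-1. *)
Definition resolvent (A A' : operator H) (C : H -> H) := forall u,
  [/\ dom A (C u), dom A' (A (C u)) & A' (A (C u)) = u - C u].

(** The inclusion LA ⊂ AL, which is how an everywhere defined function commutes
    with an unbounded operator. *)
Definition commutes (A : operator H) L :=
  forall x, dom A x -> dom A (L x) /\ A (L x) = L (A x).

Lemma resolvent_exists : exists C, resolvent A A' C.
Proof. by have /choice [C hC] := np_resolvent nA; exists C. Qed.

Section WithC.
Variables (C : H -> H) (rC : resolvent A A' C).

Lemma res_uniq x u : dom A x -> dom A' (A x) -> A' (A x) = u - x -> C u = x.
Proof.
by move=> Ax A'Ax e; have [h1 h2 h3] := rC u;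
  exact: (np_resolvent_inj nA h1 h2 h3 Ax A'Ax e).
Qed.

Lemma resolventC : resolvent A' A C.
Proof.
move=> u; have [h1 h2 h3] := rC u; have [h4 h5] := (np_comm nA _).1 (conj h1 h2).
by split => //; rewrite -h3 (np_commE nA).
Qed.

Lemma res_dot u v : rdot (C u) v = rdot (C u) (C v) + rdot (A (C u)) (A (C v)).
Proof.
have [Au _ _] := rC u; have [Av A'Av vE] := rC v.
by rewrite (np_rdot nA)// vE !rdotE; ring.
Qed.

Lemma res_sym : adjoint_funs C C.
Proof.
move=> u v; rewrite [LHS]res_dot [RHS]rdotC [RHS]res_dot.
by congr (_ + _); exact: rdotC.
Qed.

Lemma res_linear : real_linear C.
Proof. exact: adjoint_funs_linear res_sym. Qed.

Lemma res_ge_sq u : sq (C u) <= rdot (C u) u.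
Proof. by rewrite res_dot lerDl sq_ge0. Qed.

Lemma res_ge0 u : 0 <= rdot (C u) u.
Proof. exact: le_trans (sq_ge0 _) (res_ge_sq u). Qed.

Lemma res_nrm u : nrm (C u) <= nrm u.
Proof.
have h1 := res_ge_sq u; have := rdot_le (C u) u; rewrite ger0_norm ?res_ge0// => h2.
have [->|c0] := eqVneq (nrm (C u)) 0; first exact: nrm_ge0.
have cp : 0 < nrm (C u) by rewrite lt_neqAle eq_sym c0 nrm_ge0.
by rewrite -(ler_pM2l cp) -expr2 nrm_sq (le_trans h1).
Qed.

Lemma res_le_sq u : rdot (C u) u <= sq u.
Proof.
rewrite (le_trans (ler_norm _))// (le_trans (rdot_le _ _))//.
by rewrite -nrm_sq expr2 ler_wpM2r ?nrm_ge0// res_nrm.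
Qed.

Lemma res_eq0 u : C u = 0 -> u = 0.
Proof.
by have [_ _] := rC u; move=> + C0; rewrite C0 !app0 subr0.
Qed.

(** For x in the domain of A, the vector A (C x) solves the equation that
    defines C (A x), because A'A = AA'. *)
Lemma res_commutes : commutes A C.
Proof.
move=> x Ax; have [ACx A'ACx e] := rC x; split => //; apply/esym.
have A'AC : dom A (A' (A (C x))) by rewrite e; exact: domB.
have ACd : dom A (A (C x)) by exact/(np_dom nA).
have := (np_comm nA (A (C x))).2 (conj A'ACx A'AC) => -[_ h].
by apply: res_uniq => //; rewrite (np_commE nA)// e appB.
Qed.

Lemma res_nrmA u : nrm (A (C u)) <= nrm u.
Proof.
apply: nrm_le; first exact: nrm_ge0.
rewrite nrm_sq (le_trans _ (res_le_sq u))// res_dot lerDr sq_ge0 //.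
Qed.

End WithC.

(** The vectors on which the powers of A are O(r^k). For a normal operator
    this is the spectral subspace of the disc of radius r, but the definition
    makes it visibly invariant under the bounded functions that commute with A. *)
Definition band (A : operator H) r : set H := [set x |
  (forall k, dom A (iter k A x)) /\
  exists c, forall k, nrm (iter k A x) <= c * r ^+ k].

End Resolvent.

Section Band.
Context {R : realType} {H : hilbertType R}.
Variables (A A' : operator H) (nA : normal_pair A A').
Implicit Types (x y z u v w : H) (c d r M : R) (L : H -> H).

Lemma band_dom r x : band A r x -> dom A x.
Proof. by move=> [/(_ 0%N)]. Qed.

Lemma band_subspace r : 0 <= r -> real_subspace (band A r).
Proof.
move=> r0; split.
  have i0 k : iter k A 0 = 0 by elim: k => //= k ->; rewrite app0.
  split=> [k|]; first by rewrite i0; exact: dom0.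
  by exists 0 => k; rewrite i0 nrm0 mul0r.
move=> c x y [Dx [cx hx]] [Dy [cy hy]].
have iE k : iter k A (c%:C *: x + y) = c%:C *: iter k A x + iter k A y.
  by elim: k => //= k ->; rewrite Defs.appP.
split=> [k|]; first by rewrite iE; exact: domP.
exists (`|c| * cx + cy) => k; rewrite iE (le_trans (nrmD _ _))// mulrDl lerD//.
by rewrite nrmZ -mulrA ler_wpM2l.
Qed.

Lemma band_commutes r M L x : 0 <= r -> 0 <= M -> bounded_by M L ->
  commutes A L -> band A r x -> band A r (L x).
Proof.
move=> r0 M0 LM AL [Dx [c hx]].
have iE k : iter k A (L x) = L (iter k A x).
  by elim: k => //= k ->; have [_ ->] := AL _ (Dx k).
split=> [k|]; first by rewrite iE; have [] := AL _ (Dx k).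
exists (M * c) => k; rewrite iE (le_trans (LM _))// -mulrA ler_wpM2l//.
Qed.

Lemma band_iter1 r x : 0 <= r -> band A r x -> band A r (A x).
Proof.
move=> r0 [Dx [c hx]]; split=> [k|]; first by rewrite -iterSr.
by exists (c * r) => k; rewrite -iterSr (le_trans (hx _))// exprS mulrA.
Qed.

(** |A y|^2 = <y, A'A y> <= |y| |A'A y| = |y| |A A y|, so the norms of the
    iterates form a log-convex sequence. *)
Lemma band_nrm r x : 0 <= r -> band A r x -> nrm (A x) <= r * nrm x.
Proof.
move=> r0 [Dx [c hx]].
apply: (@log_convex_ratio _ (fun k => nrm (iter k A x)) c) => // k.
  exact: nrm_ge0.
have D1 := Dx k.+1; have D0 := Dx k; rewrite /= in D1 *.
have A'D1 := (np_dom nA _).1 D1.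
rewrite nrm_sq {1}/sq (np_rdot nA)// (le_trans (ler_norm _))//.
by rewrite (le_trans (rdot_le _ _))// (np_nrm nA).
Qed.

Lemma band_adj r x : 0 <= r -> band A r x -> band A r (A' x).
Proof.
move=> r0 [Dx [c hx]].
have iE k : dom A (iter k A (A' x)) /\ iter k A (A' x) = A' (iter k A x).
  have D1 := Dx k.+1; have D0 := Dx k; rewrite /= in D1.
  elim: k D0 D1 => [|k IH] /= D0 D1.
    by split => //; have [] := np_dom2 nA D0 D1.
  have [h ->] := IH (Dx k) (Dx k.+1).
  have [h1 h2] := np_dom2 nA (Dx k) (Dx k.+1); rewrite -h2; split => //.
  by have [] := np_dom2 nA D0 D1.
split=> [k|]; first by have [] := iE k.
exists (c * r) => k; have [_ ->] := iE k.
by rewrite (np_nrm nA)// -mulrA -exprS; exact: (hx k.+1).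
Qed.

(** A' preserves the band of A, where it has the same norm as A. *)
Lemma band_sub_adj r x : 0 <= r -> band A r x -> band A' r x.
Proof.
move=> r0 hx.
have hk k : band A r (iter k A' x) /\ nrm (iter k A' x) <= nrm x * r ^+ k.
  elim: k => [|k [h1 h2]] /=; first by rewrite expr0 mulr1.
  split; first exact: band_adj.
  rewrite (np_nrm nA); last exact: band_dom h1.
  apply: le_trans (band_nrm r0 h1) _.
  by rewrite exprS mulrCA ler_wpM2l.
split=> [k|]; first by have [/band_dom/(np_dom nA)] := hk k.
by exists (nrm x) => k; have [] := hk k.
Qed.

(** If vectors of X converge to x, their images are Cauchy by linearity and the
    bound, so closedness puts x in the domain. *)
Lemma closed_extend (X : set H) r : real_subspace X -> X `<=` dom A -> 0 <= r ->
  (forall x, X x -> nrm (A x) <= r * nrm x) -> forall x, adh X x ->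
  [/\ dom A x, nrm (A x) <= r * nrm x & adh [set A y | y in X] (A x)].
Proof.
move=> sX XA r0 Xr x hx.
have /choice [y hy] : forall n, exists y, X y /\ nrm (x - y) < n.+1%:R^-1.
  by move=> n; have [|y Xy xy] := hx n.+1%:R^-1; [rewrite invr_gt0|exists y].
have [l hl] : exists l, forall d, 0 < d -> exists N, forall n, (N <= n)%N ->
    nrm (A (y n) - l) < d.
  apply: complete_seq => d d0.
  have e0 : 0 < d / (2 * (r + 1)) by rewrite divr_gt0//; lra.
  have [N hN] := natSinv_small e0; exists N => m n /hN hm /hN hn.
  have [[Xm h1] [Xn h2]] := (hy m, hy n).
  rewrite -appB; [|exact: XA|exact: XA].
  have h3 := Xr _ (subspaceB sX Xm Xn).
  have := nrmB_triangle (y m) x (y n); rewrite (nrmBC (y m) x).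
  have := lt_trans h1 hm; have := lt_trans h2 hn => h4 h5 h6.
  have : (r + 1) * nrm (y m - y n) <= (r + 1) * (2 * (d / (2 * (r + 1)))).
    by rewrite ler_pM2l; lra.
  have -> : (r + 1) * (2 * (d / (2 * (r + 1)))) = d by field; lra.
  have := nrm_ge0 (y m - y n); rewrite mulrDl mul1r => h7 h8.
  rewrite (le_lt_trans h3)// lt_neqAle.
  have [e|ne] := eqVneq (nrm (y m - y n)) 0; last first.
    have : 0 < nrm (y m - y n) by rewrite lt_neqAle eq_sym ne.
    by move=> h9; rewrite lt_eqF//=; lra.
  by rewrite e mulr0 ltW// andbT lt_eqF.
have lim d : 0 < d -> exists2 z, X z & nrm (x - z) < d /\ nrm (A z - l) < d.
  move=> d0; have [N1 h1] := hl _ d0; have [N2 h2] := natSinv_small d0.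
  have [Xy xy] := hy (N1 + N2)%N; exists (y (N1 + N2)%N) => //; split.
    by rewrite (lt_trans xy)// h2// leq_addl.
  by rewrite h1// leq_addr.
have [Ax lE] : graph A x l.
  apply: (np_closed nA) => d /lim [z Xz [h1 h2]]; exists z, (A z); split => //.
    by split => //; exact: XA.
  by rewrite nrmBC.
subst l; split=> //; last first.
  move=> d /lim [z Xz [_ h2]]; exists (A z); first by exists z.
  by rewrite nrmBC.
apply/ler_addgt0Pr => e e0.
have d0 : 0 < e / (r + 1) by rewrite divr_gt0//; lra.
have [z Xz [h1 h2]] := lim _ d0.
have := nrmB_triangle (A x) (A z) 0; have := nrmB_triangle z x 0.
rewrite !subr0 (nrmBC (A x)) (nrmBC z) => h3 h4; have h5 := Xr _ Xz.
have h6 : r * nrm z <= r * (nrm (x - z) + nrm x) by rewrite ler_wpM2l.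
have h7 : r * nrm (x - z) <= r * (e / (r + 1)) by rewrite ler_wpM2l// ltW.
have : r * (e / (r + 1)) + e / (r + 1) = e by field; lra.
lra.
Qed.

Lemma band_closed r : 0 <= r -> adh (band A r) `<=` band A r.
Proof.
move=> r0 x hx.
have hk k : adh (band A r) (iter k A x) /\ nrm (iter k A x) <= nrm x * r ^+ k.
  elim: k => [|k [h1 h2]]; first by rewrite expr0 mulr1.
  have [|Ak Ar Aadh] := closed_extend (band_subspace r0) (@band_dom r) r0 _ h1.
    by move=> y; exact: band_nrm.
  split; last by rewrite (le_trans Ar)// exprS mulrCA ler_wpM2l.
  by move=> d /Aadh [_ [y By <-] yd]; exists (A y) => //; exact: band_iter1.
split=> [k|]; last by exists (nrm x) => k; have [] := hk k.
have [h1 _] := hk k.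
have [|//] := closed_extend (band_subspace r0) (@band_dom r) r0 _ h1.
by move=> y; exact: band_nrm.
Qed.

(** Cauchy-Schwarz for the form <C x, y>, at x and y = x + A'A x: since C y = x,
    it reads |x|^4 <= <x, y> <C x, x>, where <x, y> = |x|^2 + |A x|^2. *)
Lemma band_resolvent_ge C r x : resolvent A A' C -> 0 <= r -> band A r x ->
  sq x <= (1 + r ^+ 2) * rdot (C x) x.
Proof.
move=> rC r0 hx; have Ax := band_dom hx.
have A'Ax : dom A' (A x) by apply/(np_dom nA)/(band_dom (band_iter1 r0 hx)).
pose y := x + A' (A x).
have CE : C y = x by apply: (res_uniq nA rC) => //; rewrite /y; vec.
have := @form_cauchy_schwarz _ _ C setT y x (res_sym nA rC) (conj I (fun _ _ _ _ _ => I))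
  (fun z _ => res_ge0 nA rC z) I I.
rewrite CE /y rdotDr -!/(sq _) -(np_rdot nA)// -/(sq (A x)).
have : sq (A x) <= r ^+ 2 * sq x.
  by rewrite -!nrm_sq -exprMn ler_pXn2r ?nnegrE ?mulr_ge0 ?nrm_ge0// band_nrm.
have := res_ge0 nA rC x; have := sq_ge0 x.
set s := sq x; set p := rdot _ _ => s0 p0 h1 h2.
have [->|sn0] := eqVneq s 0; first by rewrite mulr_ge0// addr_ge0// sqr_ge0.
have sp : 0 < s by rewrite lt_neqAle eq_sym sn0.
rewrite -(ler_pM2l sp) -expr2 (le_trans h2)// mulrA ler_wpM2r//; nra.
Qed.

End Band.

(** * The absolute value of a symmetric contraction *)

Section AbsoluteValue.
Context {R : realType} {H : hilbertType R}.
Implicit Types (x y z w : H) (a b c M : R) (L : H -> H).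

Lemma le_limit a b c : (forall n, a <= b + c * n.+1%:R^-1) -> a <= b.
Proof.
move=> h; apply/ler_addgt0Pr => e e0.
have c0 : 0 < `|c| + 1 by rewrite ltr_wpDl.
have [N /(_ N (leqnn N)) hN] := natSinv_small (divr_gt0 e0 c0).
have := h N; have := ler_norm c; have : 0 < N.+1%:R^-1 :> R by rewrite invr_gt0.
move: (N.+1%:R^-1 : R) hN => i hN i0 h1 h2.
have h3 : c * i <= (`|c| + 1) * i by rewrite ler_pM2r//; lra.
have h4 : (`|c| + 1) * i < (`|c| + 1) * (e / (`|c| + 1)) by rewrite ltr_pM2l.
have : (`|c| + 1) * (e / (`|c| + 1)) = e by field; lra.
lra.
Qed.

Lemma eq_limit c x y : (forall n, nrm (x - y) <= c * n.+1%:R^-1) -> x = y.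
Proof.
move=> h; apply/eqP; rewrite -subr_eq0; apply/eqP/nrm_eq0/eqP.
by rewrite eq_le nrm_ge0 andbT; apply: (@le_limit _ _ c) => n; rewrite add0r.
Qed.

Variables (E : H -> H) (Es : adjoint_funs E E) (E1 : bounded_by 1 E).

Let El : real_linear E. Proof. exact: adjoint_funs_linear Es. Qed.

Let T x := x - E (E x).

Let T_nrm x : nrm (T x) <= nrm x.
Proof.
have h z : sq (E z) <= sq z.
  rewrite -!nrm_sq ler_pXn2r ?nnegrE ?nrm_ge0//.
  by have := E1 z; rewrite mul1r.
apply: nrm_le; first exact: nrm_ge0.
rewrite nrm_sq; have := sq_ge0 (E x); have := h (E x).
by rewrite /T /sq !rdotE !Es; lra.
Qed.

Let T_sym : adjoint_funs T T.
Proof. by move=> x y; rewrite !rdotE !Es. Qed.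

(** The solution Y of 2 Y = T + Y^2 given by iteration from 0 satisfies
    (1 - Y)^2 = 1 - T = E^2, so that 1 - Y is a square root of E^2. Each
    approximation is a polynomial in T with nonnegative coefficients. *)
Fixpoint approx (n : nat) x : H :=
  if n is k.+1 then (2^-1)%:C *: (T x + approx k (approx k x)) else 0.

(** The values at 1 of these polynomials. They dominate the norms of the
    approximations, because T is a contraction and the coefficients are
    nonnegative; the same holds for the differences of two approximations. *)
Fixpoint approx1 (n : nat) : R :=
  if n is k.+1 then 2^-1 * (1 + approx1 k ^+ 2) else 0.

Let approx1S n : approx1 n.+1 = 2^-1 * (1 + approx1 n ^+ 2).
Proof. by []. Qed.

Let approxS n x :
  approx n.+1 x = (2^-1)%:C *: (T x + approx n (approx n x)).
Proof. by []. Qed.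

Let approx1_bounds n : 0 <= approx1 n /\ 1 - approx1 n <= 2 / (n%:R + 2) /\
  approx1 n <= 1.
Proof.
elim: n => [|n [h1 [h2 h3]]]; first by rewrite /= add0r; lra.
rewrite approx1S.
have h4 : 0 <= approx1 n ^+ 2 <= 1 by rewrite sqr_ge0 expr_le1.
split; [lra|split; last by lra].
have n0 : 0 <= n%:R :> R by rewrite ler0n.
rewrite -[n.+1%:R]natr1; move: (n%:R : R) n0 h2 => m m0 h2.
have h5 : 2 / (m + 2) <= 1 by rewrite ler_pdivrMr; lra.
set q := 2 / (m + 2) in h2 h5.
have qm : q * (m + 2) = 2 by rewrite /q divfK//; lra.
have q0 : 0 <= q by rewrite /q divr_ge0//; lra.
clearbody q.
(* for e = 1 - approx1, the recursion is e -> e (1 - e / 2), which is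
   increasing on [0, 1] *)
have h6 : 1 - 2^-1 * (1 + approx1 n ^+ 2) <= q - q ^+ 2 / 2.
  move: (approx1 n) h1 h2 h3 {h4} => s h1 h2 h3.
  have : 0 <= (q - (1 - s)) * (2 - (1 - s) - q) by apply: mulr_ge0; lra.
  rewrite !expr2; lra.
apply: (le_trans h6); rewrite ler_pdivlMr; last by lra.
have : q * (m + 2) * q = 2 * q by rewrite qm.
have : 0 <= q ^+ 2 by rewrite sqr_ge0.
rewrite !expr2; nra.
Qed.

Let approx_sym n : adjoint_funs (approx n) (approx n).
Proof.
elim: n => [|n IH] x y; first by rewrite /= !rdotE.
rewrite !approxS.
by rewrite rdotZl rdotZr rdotDl rdotDr T_sym !IH.
Qed.

Let approx_linear n : real_linear (approx n).
Proof. exact: adjoint_funs_linear (@approx_sym n). Qed.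

Let approx_commutes L : real_linear L -> (forall x, E (L x) = L (E x)) ->
  forall n x, approx n (L x) = L (approx n x).
Proof.
move=> Ll EL; elim=> [|n IH] x; first by rewrite /= rlin0.
rewrite !approxS.
by rewrite (rlinZ Ll) (rlinD Ll) !IH /T !EL (rlinB Ll).
Qed.

Let approxC m n x : approx m (approx n x) = approx n (approx m x).
Proof. by apply: approx_commutes => // z; rewrite approx_commutes. Qed.

Let approx_nrm n x : nrm (approx n x) <= approx1 n * nrm x.
Proof.
elim: n x => [|n IH] x; first by rewrite /= nrm0 mul0r.
rewrite approxS approx1S.
rewrite nrmZ ger0_norm// -mulrA ler_wpM2l// mulrDl mul1r.
rewrite (le_trans (nrmD _ _))// lerD ?T_nrm// (le_trans (IH _))//.
by rewrite expr2 -mulrA ler_wpM2l// (approx1_bounds n).1.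
Qed.

Let approx_nrm1 n x : nrm (approx n x) <= nrm x.
Proof.
rewrite (le_trans (approx_nrm _ _))// ler_piMl ?nrm_ge0//.
by have [_ []] := approx1_bounds n.
Qed.

(** Y_(n+2) - Y_(n+1) = (Y_(n+1) + Y_n) (Y_(n+1) - Y_n) / 2, and the same holds
   for the values at 1. *)
Let approx_step n x :
  nrm (approx n.+1 x - approx n x) <= (approx1 n.+1 - approx1 n) * nrm x.
Proof.
elim: n x => [|n IH] x.
  by rewrite !subr0 (le_trans (approx_nrm 1 x)).
have -> : approx n.+2 x - approx n.+1 x = (2^-1)%:C *: (
    approx n.+1 (approx n.+1 x - approx n x)
    + approx n (approx n.+1 x - approx n x)).
  rewrite (rlinB (approx_linear n.+1)) (rlinB (approx_linear n)) (approxC n n.+1).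
  rewrite (approxS n.+1 x) [X in _ - X = _](approxS n x); vec.
have -> : approx1 n.+2 - approx1 n.+1 =
    2^-1 * ((approx1 n.+1 + approx1 n) * (approx1 n.+1 - approx1 n)).
  rewrite (approx1S n.+1) {2}(approx1S n).
  by move: (approx1 n.+1) => u; ring.
rewrite nrmZ ger0_norm// -!mulrA ler_wpM2l// (le_trans (nrmD _ _))//.
have h1 := (approx1_bounds n.+1).1; have h0 := (approx1_bounds n).1.
rewrite mulrDl lerD// (le_trans (approx_nrm _ _))// ler_wpM2l//.
Qed.

Let approx_diff n k x :
  nrm (approx (n + k) x - approx n x) <= (approx1 (n + k) - approx1 n) * nrm x.
Proof.
elim: k => [|k IH]; first by rewrite addn0 !subrr nrm0 mul0r.
rewrite addnS (le_trans (nrmB_triangle _ (approx (n + k) x) _))//.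
rewrite (le_trans (lerD (approx_step _ _) IH))// -mulrDl ler_wpM2r ?nrm_ge0//.
by rewrite addrA subrK.
Qed.

Let approx_cauchy n k x :
  nrm (approx (n + k) x - approx n x) <= 2 * nrm x * n.+1%:R^-1.
Proof.
rewrite (le_trans (approx_diff _ _ _))// mulrAC ler_wpM2r ?nrm_ge0//.
have [_ [h _]] := approx1_bounds n; have [_ [_ h1]] := approx1_bounds (n + k).
rewrite (@le_trans _ _ (2 / (n%:R + 2)))//; first by lra.
have n0 : 0 <= n%:R :> R by rewrite ler0n.
by rewrite -[n.+1%:R]natr1 ler_wpM2l// lef_pV2 ?posrE; lra.
Qed.

Let limit_exists : exists Y : H -> H, forall x n,
  nrm (approx n x - Y x) <= 2 * nrm x * n.+1%:R^-1.
Proof.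
suff /choice [Y hY] : forall x, exists l, forall n,
    nrm (approx n x - l) <= 2 * nrm x * n.+1%:R^-1 by exists Y.
move=> x.
have [l hl] : exists l, forall d, 0 < d -> exists N, forall n, (N <= n)%N ->
    nrm (approx n x - l) < d.
  apply: complete_seq => d d0.
  have c0 : 0 < 4 * nrm x + 1 by have := nrm_ge0 x; lra.
  have [N /(_ N (leqnn N)) hN] := natSinv_small (divr_gt0 d0 c0).
  exists N => m n Nm Nn.
  have := nrmB_triangle (approx m x) (approx N x) (approx n x).
  rewrite (nrmBC (approx N x)).
  have := approx_cauchy N (m - N) x; have := approx_cauchy N (n - N) x.
  rewrite !subnKC//; have : 0 < N.+1%:R^-1 :> R by rewrite invr_gt0.
  move: (N.+1%:R^-1 : R) hN => i; rewrite ltr_pdivlMr// => hN i0 h1 h2 h3.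
  have := mulr_ge0 (nrm_ge0 x) (ltW i0); lra.
exists l => n; apply/ler_addgt0Pr => e e0.
have [N hN] := hl _ e0; have := hN (n + N)%N (leq_addl _ _).
have := approx_cauchy n N x; rewrite nrmBC => h1 h2.
by rewrite (le_trans (nrmB_triangle _ (approx (n + N) x) _))// lerD// ltW.
Qed.

(** Z is |E|, the positive square root of E^2. It inherits from the
    approximations the commutation with everything that commutes with E. *)
Lemma abs_exists : exists Z : H -> H, [/\ adjoint_funs Z Z,
  forall x, 0 <= rdot (Z x) x,
  forall x, Z (Z x) = E (E x) &
  forall L M, real_linear L -> 0 <= M -> bounded_by M L ->
    (forall x, E (L x) = L (E x)) -> forall x, Z (L x) = L (Z x)].
Proof.
have [Y hY] := limit_exists.
have Ysym : adjoint_funs Y Y.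
  move=> x y; apply/eqP; rewrite -subr_eq0 -normr_le0.
  apply: (@le_limit _ _ (4 * nrm x * nrm y)) => n; rewrite add0r.
  have -> : rdot (Y x) y - rdot x (Y y) =
      - rdot (approx n x - Y x) y + rdot x (approx n y - Y y).
    by rewrite !(rdotDl, rdotDr, rdotNl, rdotNr) (approx_sym n x y); ring.
  rewrite (le_trans (ler_normD _ _))// normrN.
  have h1 : `|rdot (approx n x - Y x) y| <= 2 * nrm x * n.+1%:R^-1 * nrm y.
    by rewrite (le_trans (rdot_le _ _))// ler_wpM2r ?nrm_ge0.
  have h2 : `|rdot x (approx n y - Y y)| <= nrm x * (2 * nrm y * n.+1%:R^-1).
    by rewrite (le_trans (rdot_le _ _))// ler_wpM2l ?nrm_ge0.
  by move: (n.+1%:R^-1 : R) h1 h2 => i h1 h2; lra.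
have Yl := adjoint_funs_linear Ysym.
have Ynrm x : nrm (Y x) <= nrm x.
  apply: (@le_limit _ _ (2 * nrm x)) => n.
  have := nrmB_triangle (Y x) (approx n x) 0; rewrite !subr0 nrmBC.
  have := hY x n; have := approx_nrm1 n x; move: (n.+1%:R^-1 : R) => i; lra.
have Ysq x : Y x = (2^-1)%:C *: (T x + Y (Y x)).
  apply: (@eq_limit (4 * nrm x)) => n.
  have -> : Y x - (2^-1)%:C *: (T x + Y (Y x)) = - (approx n.+1 x - Y x) +
      (2^-1)%:C *: (approx n (approx n x - Y x) + (approx n (Y x) - Y (Y x))).
    rewrite (rlinB (approx_linear n)) approxS; vec.
  rewrite (le_trans (nrmD _ _))// nrmN nrmZ ger0_norm//.
  have h1 : nrm (approx n.+1 x - Y x) <= 2 * nrm x * n.+1%:R^-1.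
    rewrite (le_trans (hY x n.+1))// ler_wpM2l// ?mulr_ge0 ?nrm_ge0//.
    by rewrite lef_pV2 ?posrE// ler_nat.
  have h2 := nrmD (approx n (approx n x - Y x)) (approx n (Y x) - Y (Y x)).
  have h3 : nrm (approx n (approx n x - Y x)) <= 2 * nrm x * n.+1%:R^-1.
    exact: le_trans (approx_nrm1 _ _) (hY x n).
  have h4 : nrm (approx n (Y x) - Y (Y x)) <= 2 * nrm x * n.+1%:R^-1.
    rewrite (le_trans (hY (Y x) n))// ler_wpM2r ?invr_ge0//.
    by rewrite ler_wpM2l.
  move: (n.+1%:R^-1 : R) h1 h2 h3 h4 => i h1 h2 h3 h4; lra.
exists (fun x => x - Y x); split.
- by move=> x y; rewrite !rdotE Ysym.
- move=> x; rewrite rdotDl rdotNl subr_ge0 (le_trans (ler_norm _))//.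
  rewrite (le_trans (rdot_le _ _))// -/(sq x) -nrm_sq expr2.
  by rewrite ler_wpM2r ?nrm_ge0.
- move=> x; rewrite (rlinB Yl).
  apply: rdot_inj => z; have := congr1 (fun u => rdot u z) (Ysq x).
  by rewrite /T !rdotE; lra.
- move=> L M Ll M0 LM EL x.
  suff -> : Y (L x) = L (Y x) by rewrite rlinB.
  apply: (@eq_limit (2 * nrm (L x) + M * (2 * nrm x))) => n.
  have -> : Y (L x) - L (Y x) = - (approx n (L x) - Y (L x)) + L (approx n x - Y x).
    rewrite (rlinB Ll) approx_commutes//; vec.
  rewrite (le_trans (nrmD _ _))// nrmN mulrDl lerD// (le_trans (LM _))//.
  by rewrite -mulrA ler_wpM2l.
Qed.

End AbsoluteValue.

(** * The bands are spectral subspaces *)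

Section Cutoff.
Context {R : realType} {H : hilbertType R}.
Variables (A A' : operator H) (nA : normal_pair A A').
Variables (C : H -> H) (rC : resolvent A A' C).
Implicit Types (x y z w : H).

(** The disc of this radius is the set of the z with 1 / (1 + |z|^2) >= t. *)
Definition cutoff_radius (t : R) := Num.sqrt (t^-1 - 1).

Section Level.
Variables (t : R) (t0 : 0 < t) (t1 : t <= 1).

Let r := cutoff_radius t.

Let r0 : 0 <= r. Proof. exact: sqrtr_ge0. Qed.

Let r2 : r ^+ 2 = t^-1 - 1.
Proof. by rewrite sqr_sqrtr// subr_ge0 invf_ge1. Qed.

Lemma band_ge x : band A r x -> t * sq x <= rdot (C x) x.
Proof.
move=> /(band_resolvent_ge nA rC r0); rewrite r2 addrC subrK.
by rewrite -(ler_pM2l t0) mulrA divff ?mul1r// gt_eqF.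
Qed.

Let E x := C x - t%:C *: x.

Let E_sym : adjoint_funs E E.
Proof. by move=> x y; rewrite !rdotE (res_sym nA rC). Qed.

Let El : real_linear E. Proof. exact: adjoint_funs_linear E_sym. Qed.

Let E_nrm : bounded_by 1 E.
Proof.
move=> x; rewrite mul1r; apply: nrm_le; first exact: nrm_ge0.
rewrite nrm_sq; have := res_ge_sq nA rC x; have := res_le_sq nA rC x.
have := res_ge0 nA rC x.
rewrite [sq (E x)]/sq !rdotE -/(sq (C x)) -/(sq x) (rdotC x).
move: (rdot _ _) (sq (C x)) (sq x) => p c s p0 ps cp.
have h1 : 0 <= (1 - t) * (s - p) by rewrite mulr_ge0 ?subr_ge0.
have h2 : 0 <= t * p by rewrite mulr_ge0// ltW.
have h3 : 0 <= t * (1 - t) * s.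
  by rewrite !mulr_ge0 ?subr_ge0// ?(le_trans p0 ps)// ltW.
clear r r0 r2; lra.
Qed.

(** Let E = C - t. On the kernel K of |E| - E one has C >= t, so A'A is bounded
    by 1/t - 1 there, and K lies in the band. Hence x is orthogonal to K, which
    contains the range of |E| + E, because |E|^2 = E^2. So |E| x = - E x, and
    <E x, x> <= 0. *)
Lemma band_orthogonal_le x : (forall a, band A r a -> rdot x a = 0) ->
  rdot (C x) x <= t * sq x.
Proof.
have [Z [Zs Z0 ZE Zc]] := abs_exists E_sym E_nrm.
have Zl := adjoint_funs_linear Zs.
have Cl := res_linear nA rC.
have CE y : E (C y) = C (E y) by rewrite /E (rlinB Cl) (rlinZ Cl).
have C1 : bounded_by 1 C by move=> y; rewrite mul1r (res_nrm nA rC).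
have ZC := Zc _ _ Cl ler01 C1 CE.
have ZEc := Zc _ _ El ler01 E_nrm (fun=> erefl).
(* A preserves K: it does so on the range of C, where it is the bounded
   operator A C, and this range is dense in K. *)
pose D y := A (C y).
have Dl : real_linear D.
  move=> c y z; rewrite /D Cl Defs.appP//.
    by have [] := rC y.
  by have [] := rC z.
have D1 : bounded_by 1 D by move=> y; rewrite mul1r (res_nrmA nA rC).
have DE y : E (D y) = D (E y).
  rewrite {2}/E (rlinB Dl) (rlinZ Dl) /E /D; congr (_ - _).
  have [ACy _ _] := rC y.
  by have [_ ->] := res_commutes nA rC ACy.
have ZD := Zc _ _ Dl ler01 D1 DE.
pose K : set H := [set y | Z y = E y].
have sK : real_subspace K.
  by split=> [|c y z]; rewrite /K/= ?(rlin0 Zl) ?(rlin0 El)// Zl El => -> ->.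
have cK : adh K `<=` K.
  move=> y hy; apply: rdot_inj => v; apply/eqP.
  rewrite -subr_eq0 Zs E_sym -rdotNr -rdotDr rdotC; apply/eqP.
  apply: adh_orthogonal hy => a Ka.
  by rewrite rdotC rdotDr rdotNr -Zs -E_sym Ka subrr.
have KC y : K y -> K (C y) by rewrite /K/= ZC CE => ->.
have KD y : K y -> K (D y) by rewrite /K/= ZD DE => ->.
have K_ge y : K y -> t * sq y <= rdot (C y) y.
  by move=> Ky; have := Z0 y; rewrite Ky /E !rdotE subr_ge0.
pose CK : set H := [set C y | y in K].
have sCK : real_subspace CK.
  split; first by exists 0; [case: sK|exact: rlin0].
  move=> c _ _ [y Ky <-] [z Kz <-]; exists (c%:C *: y + z); last exact: Cl.
  by have [_] := sK; apply.
have CK_dom : CK `<=` dom A by move=> _ [y _ <-]; have [] := rC y.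
have CK_nrm y : CK y -> nrm (A y) <= r * nrm y.
  move=> [z Kz <-]; have [Az A'Az e] := rC z.
  apply: nrm_le; first by rewrite mulr_ge0// nrm_ge0.
  rewrite exprMn nrm_sq r2 {1}/sq (np_rdot nA)// e rdotDr rdotNr -/(sq (C z)).
  have := K_ge _ Kz; have := cauchy_schwarz (C z) z.
  have := res_ge0 nA rC z; have := sq_ge0 (C z).
  move: (rdot _ _) (sq (C z)) (sq z) => p q s q0 p0 h1 h2.
  suff : t * p <= q.
    move=> h; rewrite mulrBl mul1r lerD2r -(ler_pM2l t0) mulrA divff ?mul1r//.
    by rewrite gt_eqF.
  have [->|pn0] := eqVneq p 0; first by rewrite mulr0.
  have pp : 0 < p by rewrite lt_neqAle eq_sym pn0.
  rewrite -(ler_pM2l pp).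
  have : t * p ^+ 2 <= t * (q * s) by rewrite ler_pM2l.
  have : q * (t * s) <= q * p by rewrite ler_wpM2l.
  rewrite expr2; lra.
have aCK : adh CK `<=` K.
  move=> y hy; apply: cK => d /hy [_ [z Kz <-] h]; exists (C z) => //.
  exact: KC.
have K_CK y : K y -> adh CK y.
  move=> Ky.
  have [p hp hw] := projection (adh_real_subspace sCK) (@adh_closed _ _ CK) y.
  have Kw : K (y - p) by apply: subspaceB => //; exact: aCK.
  suff /eqP : y - p = 0 by rewrite subr_eq0 => /eqP ->.
  apply: sq_le0; have := K_ge _ Kw.
  rewrite rdotC hw; first by rewrite pmulr_rle0.
  by apply: subset_adh; exists (y - p).
have K_band y : K y -> band A r y.
  move=> Ky; have step z : K z -> [/\ dom A z, nrm (A z) <= r * nrm z & K (A z)].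
    move=> Kz; have [Az h1 h2] := closed_extend nA sCK CK_dom r0 CK_nrm (K_CK _ Kz).
    split=> //; apply: cK => d /h2 [_ [_ [v Kv <-] <-] h].
    by exists (A (C v)) => //; exact: KD.
  have hk k : K (iter k A y) /\ nrm (iter k A y) <= nrm y * r ^+ k.
    elim: k => [|k [h1 h2]]; first by rewrite expr0 mulr1.
    have [_ h3 h4] := step _ h1; split => //.
    by apply: le_trans h3 _; rewrite exprS mulrCA ler_wpM2l.
  split=> [k|]; first by have [/step []] := hk k.
  by exists (nrm y) => k; have [] := hk k.
move=> hx; pose w := Z x + E x.
have Kw : K w by rewrite /K/= /w (rlinD Zl) (rlinD El) ZE ZEc addrC.
have KEw : K (E w).
  by rewrite /K/= ZEc; congr E.
have w0 : w = 0.
  apply: sq_eq0.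
  have -> : sq w = rdot x (Z w + E w).
    by rewrite /sq {1}/w rdotDl Zs E_sym rdotDr.
  by rewrite Kw rdotDr hx ?addr0//; exact: K_band.
have e : rdot w x = 0 by rewrite w0 rdot0l.
by have := Z0 x; move: e; rewrite /w /E !rdotE; rewrite -/(sq x); lra.
Qed.

End Level.

End Cutoff.

(** * Fuglede's theorem *)

Section Shell.
Context {R : realType} {H : hilbertType R}.
Implicit Types (x y z w : H) (X : set H).

(** The commutator of S and C is that of S and E = C - a. On X the form of E
    lies between 0 and e, so the norm of E is at most e by Cauchy-Schwarz. *)
Lemma shell_commutator (C S : H -> H) X (a e M : R) :
  adjoint_funs C C -> real_linear S -> 0 <= M -> bounded_by M S -> 0 <= e ->
  real_subspace X -> (forall x, X x -> X (C x)) -> (forall x, X x -> X (S x)) ->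
  (forall x, X x -> a * sq x <= rdot (C x) x <= (a + e) * sq x) ->
  forall x, X x -> nrm (S (C x) - C (S x)) <= 2 * M * e * nrm x.
Proof.
move=> Cs Sl M0 SM e0 sX XC XS XCa x Xx.
pose E y := C y - a%:C *: y.
have Es : adjoint_funs E E by move=> y z; rewrite !rdotE Cs.
have XE y : X y -> X (E y).
  move=> Xy; apply: subspaceB => //; first exact: XC.
  by rewrite -[_ *: y]addr0; have [X0] := sX; apply.
have Ege y : X y -> 0 <= rdot (E y) y <= e * sq y.
  move=> /XCa; rewrite /E !rdotE -/(sq y) => /andP[h1 h2].
  by apply/andP; split; lra.
have E_small y : X y -> nrm (E y) <= e * nrm y.
  move=> Xy; apply: nrm_le; first by rewrite mulr_ge0// nrm_ge0.
  have := form_cauchy_schwarz Es sX (fun z Xz => (andP (Ege z Xz)).1) Xy (XE _ Xy).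
  rewrite -/(sq _) exprMn nrm_sq.
  have [/andP[p0 p1] /andP[q0 q1]] := (Ege _ Xy, Ege _ (XE _ Xy)).
  have := sq_ge0 (E y).
  move: (sq (E y)) (rdot (E y) y) (rdot (E (E y)) (E y)) p0 p1 q0 q1
    => n p q p0 p1 q0 q1 n0 h.
  have [->|nn0] := eqVneq n 0; first by rewrite mulr_ge0 ?sqr_ge0// sq_ge0.
  have np : 0 < n by rewrite lt_neqAle eq_sym nn0.
  rewrite -(ler_pM2l np) -expr2 (le_trans h)//.
  rewrite (le_trans (ler_pM p0 q0 p1 q1))//.
  by rewrite le_eqVlt; apply/orP; left; apply/eqP; ring.
have -> : S (C x) - C (S x) = S (E x) - E (S x).
  rewrite /E (rlinB Sl) (rlinZ Sl); vec.
rewrite (le_trans (nrmD _ _))// nrmN.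
have h1 : nrm (S (E x)) <= M * (e * nrm x).
  by rewrite (le_trans (SM _))// ler_wpM2l// E_small.
have h2 : nrm (E (S x)) <= e * (M * nrm x).
  by rewrite (le_trans (E_small _ (XS _ Xx)))// ler_wpM2l.
lra.
Qed.

End Shell.

Section Fuglede.
Context {R : realType} {H : hilbertType R}.
Variables (A A' : operator H) (nA : normal_pair A A').
Variables (S S' : H -> H) (M : R).
Hypotheses (SS' : adjoint_funs S S') (M0 : 0 <= M).
Hypotheses (SM : bounded_by M S) (S'M : bounded_by M S').
Hypothesis AS : commutes A S.
Implicit Types (x y z w : H).

Let Sl : real_linear S. Proof. exact: adjoint_funs_linear SS'. Qed.

(** For x in the domain of A, <A x, S' y> = <A S x, y> = <x, S' A' y>. *)
Lemma commutes_adjoint : commutes A' S'.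
Proof.
move=> y A'y; apply/(np_adj nA) => x Ax.
have [ASx e] := AS Ax.
by rewrite -SS' -e (np_rdot nA)// SS'.
Qed.

Let r := @cutoff_radius R.

Let r_ge0 t : 0 <= r t. Proof. exact: sqrtr_ge0. Qed.

Let band_S t x : band A (r t) x -> band A (r t) (S x).
Proof. exact: (band_commutes (r_ge0 t) M0 SM AS). Qed.

(** The bands of A and A' coincide, and S' commutes with A'. *)
Let band_S' t x : band A (r t) x -> band A (r t) (S' x).
Proof.
move=> /(band_sub_adj nA (r_ge0 t)) h.
apply: (band_sub_adj (normal_pairC nA) (r_ge0 t)).
by apply: (band_commutes (r_ge0 t) M0 S'M) => //; exact: commutes_adjoint.
Qed.

Section WithC.
Variables (C : H -> H) (rC : resolvent A A' C).

Let Cs := res_sym nA rC.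

Let band_C t x : band A (r t) x -> band A (r t) (C x).
Proof.
have := res_commutes nA rC; apply: band_commutes (r_ge0 t) (ler01) _.
by move=> y; rewrite mul1r (res_nrm nA rC).
Qed.

Section Grid.
Variable n : nat.

Let e : R := n.+1%:R^-1.

Let e0 : 0 < e. Proof. by rewrite invr_gt0. Qed.

(** On level i the operator C is at least i e, where e = 1 / (n + 1). The formula
   for the positive indices does not apply to 0, since inversion maps 0 to 0. *)
Let level (i : nat) : set H :=
  if i is 0%N then setT else band A (r (i%:R * e)).

Let grid_gt0 (i : nat) : 0 < i.+1%:R * e. Proof. by rewrite mulr_gt0. Qed.

Let grid_le1 (i : nat) : (i <= n.+1)%N -> i%:R * e <= 1.
Proof. by move=> h; rewrite ler_pdivrMr// mul1r ler_nat. Qed.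

Let level_subspace i : real_subspace (level i).
Proof. by case: i => [|i]; [split|apply: band_subspace; exact: r_ge0]. Qed.

Let level_closed i : adh (level i) `<=` level i.
Proof. by case: i => [|i] x //; apply: (band_closed nA); exact: r_ge0. Qed.

Let level_C i x : level i x -> level i (C x).
Proof. by case: i => [|i]//; exact: band_C. Qed.

Let level_S i x : level i x -> level i (S x).
Proof. by case: i => [|i]//; exact: band_S. Qed.

Let level_S' i x : level i x -> level i (S' x).
Proof. by case: i => [|i]//; exact: band_S'. Qed.

Let level_ge i x : (i <= n.+1)%N -> level i x -> i%:R * e * sq x <= rdot (C x) x.
Proof.
case: i => [|i] hi; first by rewrite !mul0r (res_ge0 nA rC).
by apply: (band_ge nA rC) => //; exact: grid_le1.
Qed.

Let level_nested i : (i.+1 <= n.+1)%N -> level i.+1 `<=` level i.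
Proof.
case: i => [|i] hi x //= [Dx [c hx]]; split => //; exists c => k.
have c0 : 0 <= c by have := hx 0%N; rewrite expr0 mulr1; exact/le_trans/nrm_ge0.
rewrite (le_trans (hx k))// ler_wpM2l// lerXn2r ?nnegrE//.
rewrite ler_wsqrtr// lerD2r lef_pV2 ?posrE//.
by rewrite ler_wpM2r ?(ltW e0)// ler_nat.
Qed.

Let gap i x : (i < n.+1)%N -> (forall a, level i.+1 a -> rdot x a = 0) ->
  rdot (C x) x <= (i%:R * e + e) * sq x.
Proof.
move=> hi h; have -> : i%:R * e + e = i.+1%:R * e by rewrite -natr1; ring.
by apply: (band_orthogonal_le nA rC) => //; exact: grid_le1.
Qed.

Let Q x := S (C x) - C (S x).

(** Downward induction on the level. A vector of level i is the sum of its
    projection onto level i + 1 and of a vector on which C is within e of the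
    scalar i e. The commutator preserves the orthogonality of these two pieces,
    so the errors do not add up. *)
Let level_commutator k : (k <= n.+1)%N -> forall x, level (n.+1 - k)%N x ->
  nrm (Q x) <= 2 * M * e * nrm x.
Proof.
have c0 : 0 <= 2 * M * e := mulr_ge0 (mulr_ge0 (ler0n _ 2) M0) (ltW e0).
elim: k => [|k IH] hk x.
  rewrite subn0 => Lx; apply: (shell_commutator (a := 1) Cs Sl M0 SM (ltW e0)
    (level_subspace n.+1) (@level_C n.+1) (@level_S n.+1)) => // y /level_ge.
  move=> /(_ (leqnn _)); rewrite /e divff// mul1r => ->/=.
  by rewrite (le_trans (res_le_sq nA rC y))// ler_peMl ?sq_ge0// lerDl ltW.
set i := (n.+1 - k.+1)%N => Lx.
have ik : (n.+1 - k)%N = i.+1 by rewrite /i subnSK.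
have hi : (i < n.+1)%N by rewrite -ik leq_subr.
rewrite ik in IH.
have [p Lp hp] := projection (level_subspace i.+1) (@level_closed i.+1) x.
pose X : set H := [set y | level i y /\ forall a, level i.+1 a -> rdot y a = 0].
have sX : real_subspace X.
  split; first by split; [case: (level_subspace i)|move=> a _; rewrite rdot0l].
  move=> c y z [Ly hy] [Lz hz]; split; first by have [_] := level_subspace i; apply.
  by move=> a La; rewrite rdotDl rdotZl hy// hz// mulr0 addr0.
have XC y : X y -> X (C y).
  move=> [Ly hy]; split; first exact: level_C.
  by move=> a La; rewrite Cs hy//; exact: level_C.
have XS y : X y -> X (S y).
  move=> [Ly hy]; split; first exact: level_S.
  by move=> a La; rewrite SS' hy//; exact: level_S'.
have XCe y : X y -> i%:R * e * sq y <= rdot (C y) y <= (i%:R * e + e) * sq y.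
  by move=> [Ly hy]; rewrite level_ge ?gap// ltnW.
have Xq : X (x - p).
  by split => //; apply: subspaceB => //; exact: level_nested.
have Qq := shell_commutator Cs Sl M0 SM (ltW e0) sX XC XS XCe Xq.
have Qp : nrm (Q p) <= 2 * M * e * nrm p by apply: IH => //; exact: ltnW.
have LQp : level i.+1 (Q p).
  by apply: subspaceB => //; [exact/level_S/level_C|exact/level_C/level_S].
have [_ XQq] : X (Q (x - p)).
  by apply: subspaceB => //; [exact/XS/XC|exact/XC/XS].
have QE : Q x = Q (x - p) + Q p.
  rewrite {2}/Q (rlinB (res_linear nA rC)) !(rlinB Sl).
  by rewrite (rlinB (res_linear nA rC)) /Q; vec.
have pyth (u v : H) : rdot u v = 0 -> nrm (u + v) ^+ 2 = nrm u ^+ 2 + nrm v ^+ 2.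
  by move=> uv; rewrite !nrm_sq /sq !rdotE (rdotC v) uv; ring.
have xE : nrm x ^+ 2 = nrm (x - p) ^+ 2 + nrm p ^+ 2.
  by rewrite -pyth ?subrK// hp.
rewrite -(@ler_pXn2r _ 2)// ?nnegrE ?(mulr_ge0 c0) ?nrm_ge0//.
rewrite exprMn xE QE (pyth (Q (x - p)) (Q p)); last exact: XQq _ LQp.
by rewrite mulrDr -!exprMn lerD// ler_pXn2r ?nnegrE ?(mulr_ge0 c0) ?nrm_ge0.
Qed.

Lemma commutator_le x : nrm (Q x) <= 2 * M * nrm x * e.
Proof.
by have := @level_commutator n.+1 (leqnn _) x; rewrite subnn mulrAC; exact.
Qed.

End Grid.

Lemma resolvent_commutes x : S (C x) = C (S x).
Proof. by apply: eq_limit => n; exact: commutator_le. Qed.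

End WithC.

(** Let y be in the domain of A'A. As S commutes with C, it commutes with A'A,
    so the defect d = A'Sy - SA'y satisfies A d = 0, hence also A S' d = 0,
    because S' commutes with A' and |A x| = |A' x|. Therefore
    <d, d> = <Sy, A d> - <y, A S' d> = 0. The general case is reduced to this
    one by applying C. *)
Lemma fuglede : commutes A' S.
Proof.
have [C rC] := resolvent_exists nA.
have SC := resolvent_commutes rC.
have rC' := resolventC nA rC.
have core y : dom A y -> dom A' (A y) -> A' (S y) = S (A' y).
  move=> Ay A'Ay.
  have [A'y AA'y] := (np_comm nA y).1 (conj Ay A'Ay).
  have yE : C (y + A' (A y)) = y by apply: (res_uniq nA rC) => //; vec.
  have [ASy ASyE] := AS Ay.
  have A'Sy : dom A' (S y) by exact/(np_dom nA).
  have [ASAy ASAyE] := AS AA'y.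
  have [_ A'ASy SyE] := rC (S (y + A' (A y))).
  rewrite -SC yE in A'ASy SyE.
  have [_ AA'Sy] := (np_comm nA (S y)).1 (conj ASy A'ASy).
  set d := A' (S y) - S (A' y).
  have Ad : dom A d by exact: domB.
  have Ad0 : A d = 0.
    rewrite appB// -(np_commE nA)// SyE ASAyE -(np_commE nA)//.
    by rewrite (rlinD Sl); vec.
  have A'd0 : A' d = 0 by apply: nrm_eq0; rewrite (np_nrm nA)// Ad0 nrm0.
  have A'd : dom A' d by exact/(np_dom nA).
  have [A'S'd A'S'dE] := commutes_adjoint A'd.
  have AS'd : dom A (S' d) by exact/(np_dom nA).
  have AS'd0 : A (S' d) = 0.
    apply: nrm_eq0; rewrite -(np_nrm nA)// A'S'dE A'd0.
    by rewrite (rlin0 (adjoint_funs_linear (adjoint_funsC SS'))) nrm0.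
  have d0 : sq d = 0.
    rewrite {1}/sq {1}/d rdotDl rdotNl SS' -/d.
    rewrite (rdotC (A' (S y))) -(np_rdot nA)// (rdotC (A' y)) -(np_rdot nA)//.
    by rewrite Ad0 AS'd0 !rdot0l subr0.
  by apply/eqP; rewrite -subr_eq0; apply/eqP/sq_eq0.
move=> x A'x; have Ax : dom A x by exact/(np_dom nA).
have [ASx _] := AS Ax; have A'Sx : dom A' (S x) by exact/(np_dom nA).
split => //; apply/eqP; rewrite -subr_eq0; apply/eqP/(res_eq0 rC).
have [ACx A'ACx _] := rC x.
have [_ C1] := res_commutes (normal_pairC nA) rC' A'Sx.
have [_ C2] := res_commutes (normal_pairC nA) rC' A'x.
rewrite (rlinB (res_linear nA rC)) -C1 -SC core// C2 SC subrr //.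
Qed.

End Fuglede.

(** * The product of the two operators *)

Section Normality.
Context {R : realType} {H : hilbertType R}.
Implicit Types (x y z u v w k : H).

Lemma adjoint_funs_bounded (f f' : H -> H) M : adjoint_funs f f' -> 0 <= M ->
  bounded_by M f -> bounded_by M f'.
Proof.
move=> ff' M0 fM y; have [->|n0] := eqVneq (nrm (f' y)) 0.
  by rewrite mulr_ge0 ?nrm_ge0.
have np : 0 < nrm (f' y) by rewrite lt_neqAle eq_sym n0 nrm_ge0.
rewrite -(ler_pM2r np) -expr2 nrm_sq {1}/sq -ff' (le_trans (ler_norm _))//.
rewrite (le_trans (rdot_le _ _))// mulrAC ler_wpM2r ?nrm_ge0//.
Qed.

(** T*T = TT* as soon as T*T is contained in TT*: 1 + T*T is onto and
    1 + TT* is one-to-one, so the inclusion cannot be strict. *)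
Lemma normal_of_sub (T : operator H) : densely_defined T -> closed_op T ->
  (forall x v, dom T x -> adjr T (T x) v ->
     exists k, [/\ adjr T x k, dom T k & T k = v]) ->
  normal_op T.
Proof.
move=> dT cT sub; exists dT; split => //.
have TTs x v : dom T x -> adjr T (T x) v ->
    dom (op_comp T (op_adjoint dT)) x /\ op_comp T (op_adjoint dT) x = v.
  move=> Tx /(sub _ _ Tx) [k [/op_adjointE [Tsx <-] Tk kv]].
  by split.
have sTT x : dom (op_comp T (op_adjoint dT)) x ->
    dom T x /\ adjr T (T x) (T (op_adjoint dT x)).
  move=> [Tsx Tk]; set k := op_adjoint dT x in Tk *.
  have hk : adjr T x k by apply/(op_adjointE dT).
  have [x' Tx' hx'] := graph_projection ((closed_opP T).1 cT) (x + T k) 0.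
  have hv : adjr T (T x') (x + T k - x').
    by move=> z Tz; have := hx' z Tz; rewrite !rdotE; lra.
  have [k' [hk' Tk' k'E]] := sub _ _ Tx' hv.
  have hd : adjr T (x - x') (k - k').
    by move=> z Tz; rewrite !(rdotDr, rdotNr) hk// hk'.
  have := hd _ (domB Tk Tk'); rewrite appB// k'E.
  have -> : T k - (x + T k - x') = - (x - x') by vec.
  rewrite rdotNl -/(sq _) -/(sq _) => e.
  have /eqP : x - x' = 0.
    by apply: sq_eq0; have := sq_ge0 (x - x'); have := sq_ge0 (k - k'); lra.
  rewrite subr_eq0 => /eqP xx'; rewrite -xx' in Tx' hv; split => //.
  by move: hv; have -> : x + T k - x = T k by vec.
split.
  apply/seteqP; split=> x.
    by move=> /sTT [Tx /(op_adjointE dT) [? _]]; split.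
  by move=> [Tx h]; have [] := TTs x _ Tx ((op_adjointE dT _ _).2 (conj h erefl)).
move=> x /sTT [Tx /(op_adjointE dT) [_ e]].
by rewrite /= -[RHS]/(op_adjoint dT (T x)) e.
Qed.

Lemma normal_op_dense (T : operator H) : normal_op T -> densely_defined T.
Proof. by case. Qed.

Section Product.
Variables (A A' B B' : operator H) (nA : normal_pair A A') (nB : normal_pair B B').
Variables (S S' : H -> H) (M : R).
Hypotheses (SS' : adjoint_funs S S') (M0 : 0 <= M) (SM : bounded_by M S).
Hypotheses (BS : forall x, dom B (S x) /\ B (S x) = x).
Hypotheses (SB : forall x, dom B x -> S (B x) = x).
Hypothesis AB : op_eq (op_comp A B) (op_comp B A).

Let Sl : real_linear S. Proof. exact: adjoint_funs_linear SS'. Qed.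

Let dom_AB x : dom B x /\ dom A (B x) <-> dom A x /\ dom B (A x).
Proof.
have [e _] := AB; split=> hx.
  by have : dom (op_comp B A) x by rewrite -e.
by have : dom (op_comp A B) x by rewrite e.
Qed.

Let ABE x : dom B x -> dom A (B x) -> A (B x) = B (A x).
Proof. by have [_ e] := AB => Bx ABx; exact: (e x). Qed.

(** S x is in the domain of AB = BA, and evaluating both sides there gives
    A x = B A S x. *)
Lemma inverse_commutes : commutes A S.
Proof.
move=> x Ax; have [BSx BSxE] := BS x.
have hx : dom B (S x) /\ dom A (B (S x)) by rewrite BSxE.
have [ASx BASx] := (dom_AB (S x)).1 hx; split => //.
have := ABE hx.1 hx.2; rewrite BSxE => ->.
by rewrite SB.
Qed.

Let S'M : bounded_by M S'. Proof. exact: adjoint_funs_bounded SS' M0 SM. Qed.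

Let AS : commutes A S. Proof. exact: inverse_commutes. Qed.
Let A'S : commutes A' S. Proof. exact (fuglede nA SS' M0 SM S'M AS). Qed.
Let A'S' : commutes A' S'. Proof. exact (commutes_adjoint nA SS' AS). Qed.
Let AS' : commutes A S'.
Proof. exact (commutes_adjoint (normal_pairC nA) SS' A'S). Qed.

Let B'S' v : dom B' (S' v) /\ B' (S' v) = v.
Proof. by apply/(np_adj nB) => x Bx; rewrite -SS' SB. Qed.

Let S'B' y : dom B' y -> S' (B' y) = y.
Proof.
move=> B'y; apply: rdot_inj => z.
by rewrite rdotC -SS' -(np_rdot nB (BS z).1 B'y) (BS z).2 rdotC.
Qed.

Let S'_inj x y : S' x = S' y -> x = y.
Proof. by move=> e; rewrite -(B'S' x).2 e (B'S' y).2. Qed.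

Let S_normal v : S (S' v) = S' (S v).
Proof.
have [B'Sv B'Sv1] := B'S' v; have [BSS' BSS'1] := BS (S' v).
have [|B'y BB'y] := (np_comm nB (S (S' v))).1 _; first by rewrite BSS'1.
have e : B (B' (S (S' v))) = v by rewrite -(np_commE nB)// BSS'1.
by rewrite -(S'B' B'y) -(SB BB'y) e.
Qed.

(** U = B* B^-1 is unitary, because B is normal. *)
Let U x := B' (S x).

Let S'U x : S' (U x) = S x.
Proof. by apply: S'B'; apply/(np_dom nB); exact: (BS x).1. Qed.

Let US' x : U (S' x) = S x.
Proof. by rewrite /U S_normal (B'S' _).2. Qed.

(** Applying the injective S' to the projection of (U y, U A y) onto the graph
    of A gives the projection of (S y, A S y), which is already in the graph. *)
Let AU : commutes A U.
Proof.
move=> y Ay; have [x Ax hx] := graph_projection (np_closed nA) (U y) (U (A y)).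
have [A'g gE] := (np_adj nA _ _).1 hx.
have [AS'x AS'xE] := AS' Ax; have [ASy ASyE] := AS Ay.
have [A'S'g] := A'S' A'g; rewrite gE.
have S'l := adjoint_funs_linear (adjoint_funsC SS').
rewrite !(rlinB S'l) !S'U -AS'xE -ASyE => A'gE.
have Ad : dom A (S' x - S y) by exact: domB.
have := np_rdot nA Ad A'S'g; rewrite (rlinB S'l) S'U -AS'xE -ASyE A'gE.
rewrite appB// -/(sq (S' x - S y)).
have -> : rdot (A (S' x) - A (S y)) (A (S y) - A (S' x)) =
    - sq (A (S' x) - A (S y)) by rewrite /sq !rdotE; ring.
move=> e; have := sq_ge0 (A (S' x) - A (S y)); have := sq_ge0 (S' x - S y) => s1 s2.
have /eqP : S' x - S y = 0 by apply: sq_eq0; lra.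
rewrite subr_eq0 -S'U => /eqP /S'_inj xU; rewrite -xU; split=> //.
have /eqP : A (S' x) - A (S y) = 0 by apply: sq_eq0; lra.
by rewrite subr_eq0 AS'xE ASyE -S'U => /eqP /S'_inj.
Qed.

Lemma product_dense : densely_defined A -> densely_defined B ->
  densely_defined (op_comp A B).
Proof.
move=> /dense_nrm dA /dense_nrm dB; apply/dense_nrm => x d d0.
have d20 : 0 < d / 2 by lra.
have [b Bb xb] := dB x _ d20.
have M1 : 0 < M + 1 by rewrite ltr_wpDl.
have [a Aa ba] := dA (B b) _ (divr_gt0 d20 M1).
have [BSa BSaE] := BS a.
exists (S a); first by split; rewrite ?BSaE.
rewrite (le_lt_trans (nrmB_triangle _ b _))// [ltRHS]splitr ltrD//.
rewrite -(SB Bb) -(rlinB Sl) (le_lt_trans (SM _))//.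
move: ba; rewrite ltr_pdivlMr// mulrDr mulr1 mulrC.
by have := nrm_ge0 (B b - a) => h1 h2; lra.
Qed.

(** A x = S (AB x) on the domain of AB, so limits can be taken in the closed
    operator A first; the limit is in the domain of BA = AB. *)
Lemma product_closed : closed_op (op_comp A B).
Proof.
apply/closed_opP => x y h.
have [Ax ASy] : graph A x (S y).
  apply: (np_closed nA) => d d0.
  have M1 : 0 < M + 1 by rewrite ltr_wpDl.
  have [|a [b [[[Ba ABa] ->] xa yb]]] := h (Num.min d (d / (M + 1))).
    by rewrite lt_min d0 divr_gt0.
  have [Aa BAa] := (dom_AB a).1 (conj Ba ABa).
  exists a, (A a); split => //; first by rewrite (lt_le_trans xa)// ge_min lexx.
  have -> : A a = S (A (B a)) by rewrite ABE// SB.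
  rewrite -(rlinB Sl) (le_lt_trans (SM _))//.
  have : nrm (y - A (B a)) < d / (M + 1).
    by rewrite (lt_le_trans yb)// ge_min lexx orbT.
  rewrite ltr_pdivlMr// mulrDr mulr1 mulrC.
  by have := nrm_ge0 (y - A (B a)) => h1 h2; lra.
have [BSy BSyE] := BS y.
have [Bx ABx] := (dom_AB x).2 (conj Ax (eq_ind _ (dom B) BSy _ ASy)).
by split => //=; rewrite ABE// -ASy BSyE.
Qed.

(** Here w = B x and k = U A' w. The relation A'A w = S' v is obtained by testing
    on the vectors S p, and A k = U S' v = S v then gives T k = B A k = v. *)
Lemma product_sub x v : dom (op_comp A B) x ->
  adjr (op_comp A B) (op_comp A B x) v ->
  exists k, [/\ adjr (op_comp A B) x k, dom (op_comp A B) k & op_comp A B k = v].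
Proof.
move=> [Bx Aw] hv; pose w := B x; pose h := A w.
have xE : x = S w by rewrite /w SB.
have [A'h A'hE] : dom A' h /\ A' h = S' v.
  apply/(np_adj nA) => p Ap; have [BSp BSpE] := BS p.
  have := hv (S p); rewrite /= BSpE SS'; apply.
  by split; rewrite ?BSpE.
have [A'w AA'w] := (np_comm nA w).1 (conj Aw A'h).
have [AUw AUwE] := AU AA'w.
have AkE : A (U (A' w)) = S v.
  by rewrite AUwE -(np_commE nA)// A'hE US'.
have [BSv BSvE] := BS v.
have [Bk ABk] : dom B (U (A' w)) /\ dom A (B (U (A' w))).
  by apply/dom_AB; rewrite AkE.
exists (U (A' w)); split => //; last by rewrite /= ABE// AkE.
move=> p [Bp ABp] /=.
have [A'Sw A'SwE] := A'S A'w.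
rewrite {1}xE (np_rdot nA)// A'SwE (np_rdot nB)//.
by apply/(np_dom nB); exact: (BS _).1.
Qed.

End Product.

End Normality.

Theorem theorem14 (R : realType) (H : hilbertType R) (A B : operator H)
  (hA : normal_op A) (hB : normal_op B) (hBinv : invertible_op B)
  (hAB : op_eq (op_comp A B) (op_comp B A)) :
  normal_op (op_comp A B).
Proof.
have [A' nA] := normal_op_pair hA; have [B' nB] := normal_op_pair hB.
have [S [[K SK] BS SB]] := hBinv.
have Sl : real_linear S by move=> c x y; rewrite linearP.
have SM : bounded_by `|complex.Re K| S.
  move=> x; apply: (@le_trans _ _ (complex.Re K * nrm x)); last first.
    by rewrite ler_wpM2r ?nrm_ge0// ler_norm.
  have := SK x; rewrite !normE lecE => /andP[_].
  by case: (K) => a b /=; rewrite mulr0 subr0.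
have [S' SS'] := adjoint_exists Sl SM.
apply: normal_of_sub.
- exact: (product_dense SS' (normr_ge0 _) SM BS SB)
    (normal_op_dense hA) (normal_op_dense hB).
- exact: (product_closed nA SS' (normr_ge0 _) SM BS SB hAB).
- exact: (product_sub nA nB SS' (normr_ge0 _) SM BS SB hAB).
Qed.
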